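(* Let $(X,d,\mu)$, $p$, $\underline{Q}_\mu$ be as in the context. Let $\theta_2\in(0,\min\{p,\underline{Q}_\mu\})$, $\theta\in[\theta_2,p)$, let $S^1\in\mathcal{ADR}_0(X)$ and $S^2\in\mathcal{ADR}_{\theta_2}(X)$ be closed sets, $S:=S^1\cup S^2$, and $\mathfrak m_k:=2^{k\theta}\mu\lfloor_{S^1}+2^{k(\theta-\theta_2)}\mathcal H_{\theta_2}\lfloor_{S^2}$, $k\in\mathbb N_0$. Then for each $c\ge1$ there is a constant $C>0$ such that for every $f\in L_p(\mathcal H_0\lfloor_{S^1})\cap L_p(\mathcal H_{\theta_2}\lfloor_{S^2})$, $$\mathcal{BSN}_{p,\{\mathfrak m_k\},c}(f)\le C\Big(\|f^\sharp_{\mu\lfloor_{S^1}}|L_p(S^1,\mu)\|+\|f|L_p(S^1,\mu)\|+\|f|\mathrm B^{1-\theta_2/p}_p(S^2)\|+\mathcal{GL}^{(3)}_p(f)\Big).$$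
   Context: Standing setting: $(X,d)$ complete separable metric space, $\mu$ a Borel regular locally finite outer measure, $\operatorname{supp}\mu=X$, uniformly locally doubling (for every $R>0$, $\sup_{r\in(0,R]}\sup_x\mu(B_{2r}(x))/\mu(B_r(x))<\infty$). Balls are closed, $B_r(x)=\{y:d(x,y)\le r\}$, $cB_r(x)=B_{cr}(x)$, $B_k(x)=B_{2^{-k}}(x)$. A fixed $p\in(1,\infty)$; $X$ supports a weak local $(1,p)$-Poincaré inequality (for every $R>0$ there are $C,\lambda\ge1$ with $\inf_c\frac{1}{\mu(B_r(x))}\int_{B_r(x)}|f-c|d\mu\le Cr(\frac{1}{\mu(B_{\lambda r}(x))}\int_{B_{\lambda r}(x)}(\operatorname{lip}f)^pd\mu)^{1/p}$ for Lipschitz $f$, $x\in X$, $r\in(0,R]$). $\underline{Q}_\mu$ is the infimum of $Q>0$ such that for every $R>0$ there is $C$ with $(r_{B'}/r_B)^Q\le C\mu(B')/\mu(B)$ for balls $B'\subset B$, $0<r_{B'}\le r_B\le R$. Notation: $\mathrm{Av}_{G,\mathfrak m}(g)=\mathfrak m(G)^{-1}\int_Gg\,d\mathfrak m$ if $\mathfrak m(G)>0$, else $0$; $\mathcal E_{\mathfrak m}(g,G):=\inf_c\mathrm{Av}_{G,\mathfrak m}(|g-c|)$; $\mathfrak m\lfloor_S(E)=\mathfrak m(E\cap S)$. $\mathcal H_{\vartheta,\delta}(E):=\inf\{\sum\mu(B_{r_i}(x_i))r_i^{-\vartheta}:E\subset\bigcup B_{r_i}(x_i),0<r_i<\delta\}$,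 $\mathcal H_\vartheta=\lim_{\delta\to0}\mathcal H_{\vartheta,\delta}$. $\mathcal{ADR}_\vartheta(X)$: closed $S'$ with $\varkappa_1\mu(B_r(x))r^{-\vartheta}\le\mathcal H_\vartheta(B_r(x)\cap S')\le\varkappa_2\mu(B_r(x))r^{-\vartheta}$ for $x\in S'$, $r\in(0,1]$. Besov norm: $\|f|\mathrm B^s_p(S')\|:=\|f|L_p(\mathcal H_\vartheta\lfloor_{S'})\|+(\sum_{k\ge1}2^{ksp}\int_{S'}(\mathcal E_{\mathcal H_\vartheta\lfloor_{S'}}(f,B_k(x)))^pd\mathcal H_\vartheta(x))^{1/p}$ for $S'\in\mathcal{ADR}_\vartheta(X)$. Brudnyi–Shvartsman functional: for $c\ge1$, a finite family of closed balls $\{B_{r_i}(x_i)\}_{i=1}^M$ is $(S,c)$-nice if the balls are pairwise disjoint, $\max_ir_i\le1$, and $B_{cr_i}(x_i)\cap S\ne\emptyset$ for all $i$. For $r>0$, $k(r)$ is the integer with $r\in(2^{-k(r)-1},2^{-k(r)}]$; $\widetilde{\mathcal E}_{\mathfrak m_k}(f,B_r(x)):=\mathcal E_{\mathfrak m_k}(f,B_{2r}(x))$ if $B_r(x)\cap S\ne\emptyset$, else $0$. $\mathcal{BSN}_{p,\{\mathfrak m_k\},c}(f):=\sup\big(\sum_i\frac{\mu(B_{r_i}(x_i))}{r_i^p}(\widetilde{\mathcal E}_{\mathfrak m_{k(r_i)}}(f,B_{cr_i}(x_i)))^p\big)^{1/p}$, sup over all $(S,c)$-nice families. Maximal function: $f^\sharp_{\mu\lfloor_{S^1}}(x):=\sup_{r\in(0,2]}\frac1r\mathcal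 E_{\mu\lfloor_{S^1}}(f,B_r(x))$, $x\in S$. Gluing functional (with $\theta_1:=0$): $\Sigma^{i,j}_k:=\{(y,z)\in S^i\times S^j:d(y,z)\le2^{-k}\}$, $\operatorname{w}_k(y,z):=(\mu(B_k(y))\mu(B_k(z)))^{-1/2}$, $A^{i,j}_k(f)(y,z):=\mathrm{Av}_{B_k(y)\cap S^i,\mathcal H_{\theta_i}}\mathrm{Av}_{B_k(z)\cap S^j,\mathcal H_{\theta_j}}|f(y')-f(z')|$, and $\mathcal{GL}^{(3)}_p(f):=\big(\sum_{i\ne j}\sum_{k\ge1}2^{k(p-\theta_i-\theta_j)}\iint_{\Sigma^{i,j}_k}\operatorname{w}_k(y,z)(A^{i,j}_k(f)(y,z))^pd\mathcal H_{\theta_i}(y)d\mathcal H_{\theta_j}(z)\big)^{1/p}$ over $(i,j)\in\{(1,2),(2,1)\}$. *)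

(* Defs.v *)
From HB Require Import structures.
From mathcomp Require Import all_boot all_order all_algebra.
From mathcomp Require Import all_classical all_reals all_analysis.
Set Implicit Arguments. Unset Strict Implicit. Unset Printing Implicit Defensive.
Import Order.TTheory GRing.Theory Num.Theory.
Local Open Scope classical_set_scope.
Local Open Scope ring_scope.

Section Defs.
Variables (R : realType) (T : Type) (d : T -> T -> R).

Definition is_metric : Prop :=
  (forall x y, 0 <= d x y) /\ (forall x y, d x y = 0 <-> x = y) /\
  (forall x y, d x y = d y x) /\ (forall x y z, d x z <= d x y + d y z).

Definition cauchy_seq (u : nat -> T) : Prop :=
  forall e : R, 0 < e -> exists N, forall m n, (N <= m)%N -> (N <= n)%N -> d (u m) (u n) < e.

Definition converges_to (u : nat -> T) (x : T) : Prop :=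
  forall e : R, 0 < e -> exists N, forall n, (N <= n)%N -> d (u n) x < e.

Definition is_complete : Prop :=
  forall u, cauchy_seq u -> exists x, converges_to u x.

Definition is_separable : Prop :=
  exists u : nat -> T, forall x (e : R), 0 < e -> exists n, d x (u n) < e.

Definition cball (x : T) (r : R) : set T := [set y | d x y <= r].

Definition dopen (U : set T) : Prop :=
  forall x, U x -> exists r : R, 0 < r /\ [set y | d x y < r] `<=` U.

Definition dclosed (F : set T) : Prop :=
  forall x, (forall e : R, 0 < e -> exists y, F y /\ d x y < e) -> F x.

Definition borel (A : set T) : Prop := <<s [set U | dopen U] >> A.

Local Open Scope ereal_scope.

Definition is_outer_measure (mu : set T -> \bar R) : Prop :=
  mu set0 = 0 /\ (forall A, 0 <= mu A) /\
  (forall A B, A `<=` B -> mu A <= mu B) /\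
  (forall F : nat -> set T, mu (\bigcup_n F n) <= \sum_(n <oo) mu (F n)).

Definition cara (m : set T -> \bar R) (A : set T) : Prop :=
  forall B, m B = m (B `&` A) + m (B `&` ~` A).

Definition borel_regular (mu : set T -> \bar R) : Prop :=
  (forall B, borel B -> cara mu B) /\
  (forall A, exists B, borel B /\ A `<=` B /\ mu A = mu B).

Definition locally_finite (mu : set T -> \bar R) : Prop :=
  forall x, exists r : R, (0 < r)%R /\ mu (cball x r) < +oo.

Definition supp (mu : set T -> \bar R) : set T :=
  [set x | forall r : R, (0 < r)%R -> 0 < mu (cball x r)].

Definition unif_loc_doubling (mu : set T -> \bar R) : Prop :=
  forall Rad : R, (0 < Rad)%R -> exists C : R,
    forall (r : R) x, (0 < r <= Rad)%R -> mu (cball x (2 * r)) <= C%:E * mu (cball x r).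

(* \int_G g dm for nonnegative g, via the layer-cake (Choquet) formula
   \int_0^oo m({x in G : g x > t}) dt  (Lebesgue integral in t). *)
Definition oint (m : set T -> \bar R) (G : set T) (g : T -> \bar R) : \bar R :=
  \int[@lebesgue_measure R]_(t in [set t : R | (0 <= t)%R])
     m [set x | G x /\ t%:E < g x].

Definition Av (m : set T -> \bar R) (G : set T) (g : T -> \bar R) : \bar R :=
  if `[< 0 < m G >] then oint m G g * ((fine (m G))^-1)%:E else 0.

Definition Ecal (m : set T -> \bar R) (g : T -> R) (G : set T) : \bar R :=
  ereal_inf [set Av m G (fun y => (`|g y - c|)%:E) | c in [set: R]].

Definition restr (m : set T -> \bar R) (S : set T) : set T -> \bar R :=
  fun E => m (E `&` S).

Definition Lpnorm (p : R) (m : set T -> \bar R) (f : T -> R) : \bar R :=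
  (oint m setT (fun x => (`|f x|)%:E `^ p)) `^ p^-1.

Definition LpnormE (p : R) (m : set T -> \bar R) (g : T -> \bar R) : \bar R :=
  (oint m setT (fun x => g x `^ p)) `^ p^-1.

Definition outer_measurable_fun (m : set T -> \bar R) (f : T -> R) : Prop :=
  forall t : R, cara m [set x | (t < f x)%R].

Definition inLp (p : R) (m : set T -> \bar R) (f : T -> R) : Prop :=
  outer_measurable_fun m f /\ oint m setT (fun x => (`|f x|)%:E `^ p) < +oo.

Definition lipschitz (f : T -> R) : Prop :=
  exists L : R, forall x y, (`|f x - f y| <= L * d x y)%R.

Definition lip (f : T -> R) (x : T) : \bar R :=
  ereal_inf [set ereal_sup [set ereal_sup [set ((`|f y - f x|) / r)%:E | y in cball x r]
                           | r in [set r : R | (0 < r < delta)%R]]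
            | delta in [set delta : R | (0 < delta)%R]].

Definition weak_local_poincare (mu : set T -> \bar R) (p : R) : Prop :=
  forall Rad : R, (0 < Rad)%R -> exists C lam : R, (1 <= C)%R /\ (1 <= lam)%R /\
    forall f : T -> R, lipschitz f -> forall x (r : R), (0 < r <= Rad)%R ->
      Ecal mu f (cball x r) <=
      (C * r)%:E * (Av mu (cball x (lam * r)) (fun y => lip f y `^ p)) `^ p^-1.

Definition Qset (mu : set T -> \bar R) : set R :=
  [set Q : R | (0 < Q)%R /\ forall Rad : R, (0 < Rad)%R -> exists C : R,
     forall x x' (r r' : R), (0 < r' <= r)%R -> (r <= Rad)%R ->
       cball x' r' `<=` cball x r ->
       ((r' / r) `^ Q)%:E <= C%:E * (mu (cball x' r') * ((fine (mu (cball x r)))^-1)%:E)].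

Definition Qlow (mu : set T -> \bar R) : \bar R := ereal_inf [set Q%:E | Q in Qset mu].

Definition Hdelta (mu : set T -> \bar R) (th delta : R) (E : set T) : \bar R :=
  ereal_inf [set s | exists (I : set nat) (x : nat -> T) (r : nat -> R),
     (forall i, I i -> (0 < r i < delta)%R) /\
     E `<=` \bigcup_(i in I) cball (x i) (r i) /\
     s = (\esum_(i in I) (mu (cball (x i) (r i)) * ((r i) `^ (- th))%:E))%E].

(* H_theta = lim_{delta -> 0} H_{theta,delta} = sup_{delta > 0} (monotone) *)
Definition Haus (mu : set T -> \bar R) (th : R) (E : set T) : \bar R :=
  ereal_sup [set Hdelta mu th delta E | delta in [set delta : R | (0 < delta)%R]].

Definition ADR (mu : set T -> \bar R) (th : R) (S' : set T) : Prop :=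
  dclosed S' /\ exists k1 k2 : R, (0 < k1)%R /\ (0 < k2)%R /\
    forall x (r : R), S' x -> (0 < r <= 1)%R ->
      (k1 * r `^ (- th))%:E * mu (cball x r) <= Haus mu th (cball x r `&` S') /\
      Haus mu th (cball x r `&` S') <= (k2 * r `^ (- th))%:E * mu (cball x r).

Definition Besov_norm (mu : set T -> \bar R) (th p s : R) (S' : set T) (f : T -> R) : \bar R :=
  Lpnorm p (restr (Haus mu th) S') f +
  (\sum_(1 <= k <oo) ((2 `^ (k%:R * s * p))%:E *
      oint (Haus mu th) S'
        (fun x => Ecal (restr (Haus mu th) S') f (cball x (2 ^- k)) `^ p))) `^ p^-1.

(* k(r): the integer k with r in (2^{-k-1}, 2^{-k}] (nonnegative for r <= 1) *)
Definition kr (r : R) : nat := xget 0%N [set k : nat | (2 ^- k.+1 < r <= 2 ^- k)%R].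

Definition Etilde (S : set T) (m : set T -> \bar R) (f : T -> R) (x : T) (r : R) : \bar R :=
  if `[< exists y, S y /\ (d x y <= r)%R >] then Ecal m f (cball x (2 * r)) else 0.

Definition nice_family (S : set T) (c : R) (M : nat) (x : 'I_M -> T) (r : 'I_M -> R) : Prop :=
  (forall i, (0 < r i <= 1)%R) /\
  (forall i j, i != j -> cball (x i) (r i) `&` cball (x j) (r j) = set0) /\
  (forall i, exists y, S y /\ (d (x i) y <= c * r i)%R).

Definition BSN (mu : set T -> \bar R) (S : set T) (p : R) (mk : nat -> set T -> \bar R)
    (c : R) (f : T -> R) : \bar R :=
  ereal_sup [set v | exists (M : nat) (x : 'I_M -> T) (r : 'I_M -> R),
     nice_family S c x r /\
     v = (\sum_(i < M) (mu (cball (x i) (r i)) * ((r i) `^ (- p))%:E *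
            Etilde S (mk (kr (r i))) f (x i) (c * r i) `^ p)) `^ p^-1].

Definition fsharp (mu : set T -> \bar R) (S1 : set T) (f : T -> R) (x : T) : \bar R :=
  ereal_sup [set ((r^-1)%:E * Ecal (restr mu S1) f (cball x r)) | r in [set r : R | (0 < r <= 2)%R]].

Definition wk (mu : set T -> \bar R) (k : nat) (y z : T) : \bar R :=
  ((fine (mu (cball y (2 ^- k)) * mu (cball z (2 ^- k)))) `^ (- 2^-1))%:E.

Definition Ak (mu : set T -> \bar R) (Si Sj : set T) (thi thj : R) (k : nat) (f : T -> R)
    (y z : T) : \bar R :=
  Av (Haus mu thi) (cball y (2 ^- k) `&` Si)
     (fun y' => Av (Haus mu thj) (cball z (2 ^- k) `&` Sj) (fun z' => (`|f y' - f z'|)%:E)).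

Definition GLterm (mu : set T -> \bar R) (p : R) (Si Sj : set T) (thi thj : R) (f : T -> R) : \bar R :=
  \sum_(1 <= k <oo) ((2 `^ (k%:R * (p - thi - thj)))%:E *
     oint (Haus mu thj) Sj (fun z =>
       oint (Haus mu thi) [set y | Si y /\ (d y z <= 2 ^- k)%R]
         (fun y => wk mu k y z * Ak mu Si Sj thi thj k f y z `^ p))).

Definition GL3 (mu : set T -> \bar R) (p th2 : R) (S1 S2 : set T) (f : T -> R) : \bar R :=
  (GLterm mu p S1 S2 0 th2 f + GLterm mu p S2 S1 th2 0 f) `^ p^-1.

Definition mk_seq (mu : set T -> \bar R) (th th2 : R) (S1 S2 : set T) (k : nat) : set T -> \bar R :=
  fun E => (2 `^ (k%:R * th))%:E * mu (E `&` S1) +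
           (2 `^ (k%:R * (th - th2)))%:E * Haus mu th2 (E `&` S2).

End Defs.

(* Main.v *)
Require Import Defs.
From HB Require Import structures.
From mathcomp Require Import all_boot all_order all_algebra.
From mathcomp Require Import all_classical all_reals all_analysis.
From mathcomp Require Import measurable_realfun ring lra.
Set Implicit Arguments. Unset Strict Implicit. Unset Printing Implicit Defensive.
Import Order.TTheory GRing.Theory Num.Theory.
Local Open Scope classical_set_scope.
Local Open Scope ring_scope.

(** Fix a nice family of balls [B_i = B(x_i, r_i)] and let [X_i] be the oscillation of [f] over
    [2cB_i].  If [r_i] is bounded below, [X_i] is at most the mean of [|f|], and the dilated balls
    have bounded overlap, so the L_p norms of [f] suffice.  Otherwise [X_i] is bounded, uniformly
    over the points of [S^1] or [S^2] in [4cB_i], by one of three quantities: [r_i f^sharp] if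
    [2cB_i] misses [S^2]; the oscillation of [f] on [S^2] at a coarser dyadic scale if it misses
    [S^1]; and if it meets both, the latter oscillation or the mixed mean [A^(2,1)].  Such pointwise
    domination is summed by a Carleson-type argument: on each superlevel set a Vitali selection
    bounds the total measure of the disjoint balls involved by that of the superlevel set within
    [S^1] or [S^2].  This never uses measurability of the integrands, so it applies to the
    layer-cake integrals of outer measures. *)

(** * Layer-cake integrals and means *)

(** The obstacle is additivity. Layer-cake integrals for an outer measure are monotone and
    homogeneous, but the integral of a sum need not split. So each triangle inequality is turned
    into a bound by a maximum, at the cost of a factor 2: superlevel sets of a maximum are unions,
    and finite subadditivity suffices. For sums over disjoint balls the property kept is
    superadditivity over sets at positive distance, which [mu] and every [Haus d mu th] share. A
    point of S in 2cB_i carries a ball of radius r_i inside 4cB_i, and 4cB_i lies in the ball of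
    radius 8c r_i about each of its points; this gives the factor 4c and the shift [s] with 8c <=
    2^s from scale k to the coarser scale k - s. When both pieces are met, the mean of |f - a| over
    S^1 is compared with that over S^2 by recentering at f(z) and averaging over z in S^2; the error
    is a double mean, which A^(2,1) dominates. S^1 is weighed by [mu] in some functionals and by
    [Haus d mu 0] in others. The former is at most the latter, and a converse up to a constant holds
    on bounded closed sets. *)

Section Choquet.
Variables (R : realType) (T : Type).
Implicit Types (m : set T -> \bar R) (G A B : set T) (g u v w : T -> \bar R).
Local Open Scope ereal_scope.

Definition capacity m :=
  (forall A, 0 <= m A) /\ (forall A B, A `<=` B -> m A <= m B).

Definition subadd2 m := forall A B, m (A `|` B) <= m A + m B.

Definition nneg_reals : set R := [set t : R | (0 <= t)%R].

Lemma measurable_nneg_reals : measurable (nneg_reals : set (measurableTypeR R)).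
Proof.
apply: is_interval_measurable => x y /=; rewrite /nneg_reals /= => x0 _ z.
by move=> /andP[xz _]; exact: le_trans xz.
Qed.

(** Preimages of []r, +oo[] under an antitone map are intervals. The layers of a monotone set
    function are antitone in the level, so their Lebesgue integrals are well behaved for arbitrary
    integrands. *)
Lemma antitone_measurable (D : set (measurableTypeR R)) (F : R -> \bar R) :
  measurable D -> (forall s t, (s <= t)%R -> F t <= F s) -> measurable_fun D F.
Proof.
move=> mD antiF; apply: (measurability _ (ErealGenOInfty.measurableE R)) => //.
move=> /= _ [_ [r ->]] <-; apply: measurableI => //.
apply: is_interval_measurable => x y /=; rewrite !in_itv/= !andbT => _ ry z.
by move=> /andP[_ zy]; rewrite in_itv/= andbT; apply: lt_le_trans ry (antiF _ _ zy).
Qed.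

Definition layer m G g (t : R) : \bar R := m [set x | G x /\ t%:E < g x].

Lemma layer_anti m G g : capacity m ->
  forall s t, (s <= t)%R -> layer m G g t <= layer m G g s.
Proof.
move=> [_ mono] s t st; apply: mono => x [Gx tg]; split=> //.
by apply: le_lt_trans tg; rewrite lee_fin.
Qed.

Lemma measurable_layer m G g : capacity m ->
  measurable_fun (nneg_reals : set (measurableTypeR R)) (layer m G g).
Proof.
move=> cm; apply: antitone_measurable; first exact: measurable_nneg_reals.
exact: layer_anti.
Qed.

Lemma ointE m G g :
  oint m G g = \int[@lebesgue_measure R]_(t in nneg_reals) layer m G g t.
Proof. by []. Qed.

Lemma oint_ge0 m G g : capacity m -> 0 <= oint m G g.
Proof. by move=> [m0 _]; apply: integral_ge0 => t _; exact: m0. Qed.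

Lemma le_oint_scale (K : R) m m' G G' g g' : capacity m -> capacity m' -> (0 <= K)%R ->
  (forall t : R, (0 <= t)%R -> layer m G g t <= K%:E * layer m' G' g' t) ->
  oint m G g <= K%:E * oint m' G' g'.
Proof.
move=> cm cm' K0 H; rewrite !ointE -ge0_integralZl_EFin//.
- apply: ge0_le_integral => //.
  + exact: measurable_nneg_reals.
  + by move=> t _; apply: cm.1.
  + exact: measurable_layer.
  + apply: antitone_measurable; first exact: measurable_nneg_reals.
    by move=> s t st; apply: lee_wpmul2l; rewrite ?lee_fin//; exact: layer_anti.
- exact: measurable_nneg_reals.
- by move=> t _; apply: cm'.1.
- exact: measurable_layer.
Qed.

Lemma le_oint m G G' g g' : capacity m -> G `<=` G' ->
  (forall x, G x -> g x <= g' x) -> oint m G g <= oint m G' g'.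
Proof.
move=> cm GG' gg'; rewrite -[leRHS]mul1e; apply: le_oint_scale => // t t0.
rewrite mul1e; apply: cm.2 => x [Gx tg]; split; first exact: GG'.
by apply: lt_le_trans tg (gg' _ Gx).
Qed.

Lemma le_oint_add (K1 K2 : R) m m1 m2 G G1 G2 g g1 g2 :
  capacity m -> capacity m1 -> capacity m2 -> (0 <= K1)%R -> (0 <= K2)%R ->
  (forall t : R, (0 <= t)%R ->
     layer m G g t <= K1%:E * layer m1 G1 g1 t + K2%:E * layer m2 G2 g2 t) ->
  oint m G g <= K1%:E * oint m1 G1 g1 + K2%:E * oint m2 G2 g2.
Proof.
move=> cm cm1 cm2 K10 K20 H.
have mn := measurable_nneg_reals.
have M (K : R) m' G' g' : (0 <= K)%R -> capacity m' ->
    measurable_fun (nneg_reals : set (measurableTypeR R)) (fun t => K%:E * layer m' G' g' t).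
  move=> K0 cm'; apply: antitone_measurable => // s t st.
  by apply: lee_wpmul2l; rewrite ?lee_fin//; exact: layer_anti.
have L0 m' G' g' t : capacity m' -> 0 <= layer m' G' g' t by move=> [+ _]; exact.
rewrite !ointE -!ge0_integralZl_EFin//; try exact: measurable_layer; try by move=> t _; exact: L0.
rewrite -ge0_integralD//; try exact: M; try by move=> t _; rewrite mule_ge0 ?lee_fin ?L0.
apply: ge0_le_integral => //.
- by move=> t _; exact: L0.
- exact: measurable_layer.
- by apply: emeasurable_funD; exact: M.
Qed.

(** The superlevel set of a maximum is the union of the two superlevel sets, so finite subadditivity
    of [m] is enough. *)
Lemma oint_max m G g g1 g2 : capacity m -> subadd2 m ->
  (forall x, G x -> g x <= maxe (g1 x) (g2 x)) ->
  oint m G g <= oint m G g1 + oint m G g2.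
Proof.
move=> cm sm gle; rewrite -[X in _ <= X + _]mul1e -[X in _ <= _ + X]mul1e.
apply: le_oint_add => // t t0; rewrite !mul1e; apply: le_trans (sm _ _).
apply: cm.2 => x [Gx tg]; have := lt_le_trans tg (gle _ Gx).
by rewrite lt_max => /orP[]; [left|right].
Qed.

Lemma oint_ge_cst m G g (a : \bar R) : capacity m ->
  (forall x, G x -> a <= g x) -> a * m G <= oint m G g.
Proof.
move=> cm ag; have [a0|a0] := leP a 0.
  by apply: le_trans (oint_ge0 _ _ cm); rewrite mule_le0_ge0 ?cm.1.
have mn := measurable_nneg_reals.
have key (b : R) : (0 <= b)%R -> b%:E <= a -> b%:E * m G <= oint m G g.
  move=> b0 ba; rewrite ointE.
  have -> : b%:E * m G = \int[@lebesgue_measure R]_(t in `[0%R, b[) (cst (m G)) t.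
    rewrite integral_cst//= lebesgue_measure_itv/=.
    move: b0; rewrite le_eqVlt => /orP[/eqP<-|b0]; first by rewrite lte_fin ltxx mul0e mule0.
    by rewrite lte_fin b0 oppr0 adde0 muleC.
  apply: (@le_trans _ _ (\int[lebesgue_measure]_(t in `[0%R, b[) layer m G g t)).
    apply: ge0_le_integral => //.
    - by move=> t _ /=; exact: cm.1.
    - apply: measurable_funS (@measurable_layer m G g cm) => //.
      by move=> t /=; rewrite in_itv/= => /andP[].
    - move=> t /=; rewrite in_itv/= => /andP[t0 tb]; apply: cm.2 => x Gx; split=> //.
      by apply: lt_le_trans (ag _ Gx); apply: lt_le_trans ba; rewrite lte_fin.
  apply: ge0_subset_integral => //.
  - exact: measurable_layer.
  - by move=> t _; exact: cm.1.
  - by move=> t /=; rewrite in_itv/= => /andP[].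
case: a a0 ag key => [b||]//.
  by rewrite lte_fin => /ltW b0 _ /(_ b b0); exact.
move=> _ _ key.
have := cm.1 G; rewrite le_eqVlt => /orP[/eqP <-|mG0]; first by rewrite mule0 oint_ge0.
rewrite gt0_mulye//.
case: (m G) mG0 key => [c c0 key| _ key|//].
- case E : (oint m G g) => [y| |]//.
    exfalso; have y0 : (0 <= y)%R by have := oint_ge0 G g cm; rewrite E lee_fin.
    (* An infinite lower bound on a set of finite positive mass [c] forces an infinite integral: a
       finite value [y] would, for this choice of [b], satisfy [y + 1 <= y]. *)
    have := key ((y + 1) / c)%R; rewrite E -EFinM.
    rewrite lte_fin in c0.
    rewrite divfK ?gt_eqF// leey lee_fin => H.
    have : (y + 1 <= y)%R by apply: H => //; apply: divr_ge0; lra.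
    lra.
  by have := oint_ge0 G g cm; rewrite E.
- by have := key 1%R ler01 (leey _); rewrite mul1e.
Qed.

Lemma oint_le_cst m G g (b : R) : capacity m -> m set0 = 0 -> (0 <= b)%R ->
  (forall x, G x -> g x <= b%:E) -> oint m G g <= b%:E * m G.
Proof.
move=> cm m0 b0 gb.
have mn := measurable_nneg_reals.
have -> : b%:E * m G = \int[@lebesgue_measure R]_(t in `[0%R, b[) (cst (m G)) t.
  rewrite integral_cst//= lebesgue_measure_itv/=.
  move: b0; rewrite le_eqVlt => /orP[/eqP<-|b0]; first by rewrite lte_fin ltxx mul0e mule0.
  by rewrite lte_fin b0 oppr0 adde0 muleC.
rewrite ointE [leLHS]integral_mkcond [leRHS]integral_mkcond.
apply: ge0_le_integral => //.
- by move=> t _; apply: erestrict_ge0 => s _; exact: cm.1.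
- by apply/(measurable_restrictT _ _).1 => //; exact: measurable_layer.
- by apply/(measurable_restrictT _ _).1.
- move=> t _; rewrite !patchE; case: ifPn => [|_].
    rewrite inE/nneg_reals/= => t0; case: ifPn => [_|].
      by apply: cm.2 => x [].
    move/negP; rewrite inE/= in_itv/= t0/= => /negP; rewrite -leNgt => bt.
    rewrite /layer (_ : [set _ | _] = set0) ?m0//.
    apply/seteqP; split=> // x [Gx tg]; have := lt_le_trans tg (gb _ Gx).
    by rewrite lte_fin ltNge bt.
  by case: ifPn => // _; exact: cm.1.
Qed.

(** Both sides are measures in [A] that agree on half-open intervals. This is the change of variable
    in the level that makes layer-cake integrals homogeneous. *)
Lemma lebesgue_measure_dilation (a : R) : (0 < a)%R ->
  forall A : set (measurableTypeR R), measurable A ->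
  lebesgue_measure A = a%:E * lebesgue_measure ((fun t : R => a * t)%R @^-1` A).
Proof.
move=> a0.
have mphi : measurable_fun setT
    (fun t : measurableTypeR R => (a * t)%R : measurableTypeR R).
  by apply: measurable_funM.
pose nu : {measure set (measurableTypeR R) -> \bar R} :=
  mscale (NngNum (ltW a0)) (measure_function_pushforward__canonical__measure_function_Measure (@lebesgue_measure R) mphi).
apply: (@lebesgue_measure_unique _ nu) => X [[x y] /= _ <-].
rewrite /nu/= /mscale/= /pushforward/=.
have -> : (fun t : R => a * t)%R @^-1` `]x, y]%classic = `](a^-1 * x)%R, (a^-1 * y)%R]%classic.
  apply/seteqP; split=> t /=; rewrite !in_itv/= ltr_pdivrMl// ler_pdivlMl//.
rewrite !lebesgue_measure_itv/= !lte_fin ltr_pM2l ?invr_gt0//.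
case: ifPn => _; last by rewrite mule0.
by rewrite -!EFinB -EFinM -mulrBr mulVKf// gt_eqF.
Qed.

Lemma oint_scale m G g g' (a : R) : capacity m -> (0 < a)%R ->
  (forall x, G x -> g' x <= a%:E * g x) -> oint m G g' <= a%:E * oint m G g.
Proof.
move=> cm a0 gg'.
have mn := measurable_nneg_reals.
have mphi : measurable_fun setT
    (fun t : measurableTypeR R => (a * t)%R : measurableTypeR R).
  by apply: measurable_funM.
have : oint m G g' <= oint m G (fun x => a%:E * g x) by exact: le_oint.
move=> /le_trans; apply.
pose nu : {measure set (measurableTypeR R) -> \bar R} :=
  mscale (NngNum (ltW a0)) (measure_function_pushforward__canonical__measure_function_Measure (@lebesgue_measure R) mphi).
rewrite ointE (@eq_measure_integral _ _ _ _ nu); last first.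
  by move=> A mA _; exact: (lebesgue_measure_dilation a0 mA).
rewrite ge0_integral_mscale//; last 2 first.
- exact: measurable_layer.
- by move=> t _; exact: cm.1.
rewrite lee_wpmul2l//=; first by rewrite lee_fin ltW.
rewrite ge0_integral_pushforward//; last 2 first.
- exact: measurable_layer.
- by move=> t _; exact: cm.1.
rewrite (_ : _ @^-1` nneg_reals = nneg_reals); last first.
  by apply/seteqP; split=> t; rewrite /nneg_reals/= pmulr_rge0.
rewrite ointE; apply: ge0_le_integral => //.
- by move=> t _; exact: cm.1.
- apply: antitone_measurable => // s t st /=; apply: layer_anti => //.
  by rewrite ler_pM2l.
- exact: measurable_layer.
- move=> t _ /=; apply: cm.2 => x [Gx]; rewrite EFinM lte_pmul2l//.
Qed.

(** * Means and oscillations for set functions *)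

Definition posfin m G := exists2 b : R, (0 < b)%R & m G = b%:E.

(** A set of infinite mass also falls in the first case: [fine +oo] is [0], with inverse [0]. Lower
    bounds on a mean therefore ask for [posfin], upper bounds do not. *)
Lemma Av_cases m G : capacity m ->
  (forall g, Av m G g = 0) \/
  exists2 b : R, (0 < b)%R /\ m G = b%:E & forall g, Av m G g = (b^-1)%:E * oint m G g.
Proof.
move=> cm; rewrite /Av; have := cm.1 G; case: asboolP => [+ _|_ _]; last by left.
case: (m G) => [b||]// b0.
- right; exists b => [|g]; last by rewrite /= muleC.
  by rewrite lte_fin in b0.
- by left=> g; rewrite /= invr0 mule0.
Qed.

Lemma Av_posfin m G (b : R) g : (0 < b)%R -> m G = b%:E ->
  Av m G g = (b^-1)%:E * oint m G g.
Proof. by move=> b0 mG; rewrite /Av mG lte_fin b0 asboolT// muleC. Qed.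

Lemma Av_ge0 m G g : capacity m -> 0 <= Av m G g.
Proof.
move=> cm; have [->//|[b [b0 _]] ->] := Av_cases G cm.
by rewrite mule_ge0 ?oint_ge0// lee_fin invr_ge0 ltW.
Qed.

Lemma Av_ge_cst m G g (a : \bar R) : capacity m -> posfin m G ->
  (forall x, G x -> a <= g x) -> a <= Av m G g.
Proof.
move=> cm [b b0 mG] ag; rewrite (Av_posfin _ b0 mG) muleC lee_pdivlMr// -mG.
exact: oint_ge_cst.
Qed.

Lemma Av_le_cst m G g (a : R) : capacity m -> m set0 = 0 -> (0 <= a)%R ->
  (forall x, G x -> g x <= a%:E) -> Av m G g <= a%:E.
Proof.
move=> cm m0 a0 ag; have [->|[b [b0 mG]] ->] := Av_cases G cm; first by rewrite lee_fin.
by rewrite muleC lee_pdivrMr// -mG; exact: oint_le_cst.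
Qed.

(** The comparison on subsets of [G] controls the numerator, that of the total masses the
    denominator. Together they make [m' G'] finite and positive whenever [m G] is, so the larger
    mean does not degenerate to [0]. *)
Lemma le_Av_scale (K1 K2 : R) m m' G G' g g' : capacity m -> capacity m' ->
  (0 < K1)%R -> (0 <= K2)%R -> G `<=` G' ->
  (forall A, A `<=` G -> m A <= K1%:E * m' A) -> m' G' <= K2%:E * m G ->
  (forall x, G x -> g x <= g' x) ->
  Av m G g <= (K1 * K2)%:E * Av m' G' g'.
Proof.
move=> cm cm' K10 K20 GG' mm' m'm gg'.
have [->|[b [b0 mG]] ->] := Av_cases G cm.
  by rewrite mule_ge0 ?Av_ge0// lee_fin mulr_ge0// ltW.
have [b' b'0 mG'] : posfin m' G'.
  have : b%:E <= K1%:E * m' G'.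
    rewrite -mG; apply: le_trans (mm' _ (@subset_refl _ G)) _.
    by rewrite lee_wpmul2l ?lee_fin ?(ltW K10)//; exact: cm'.2.
  move: m'm; rewrite /posfin mG; case: (m' G') (cm'.1 G') => [b'||]//= b'0.
  rewrite -!EFinM !lee_fin => _ bK; exists b' => //.
  by move: (lt_le_trans b0 bK); rewrite pmulr_rgt0.
rewrite (Av_posfin _ b'0 mG').
have H : oint m G g <= K1%:E * oint m' G' g'.
  apply: le_oint_scale => //; first exact: ltW.
  move=> t t0; apply: le_trans (mm' _ _) _; first by move=> x [].
  rewrite lee_wpmul2l ?lee_fin ?(ltW K10)//; apply: cm'.2 => x [Gx tg]; split; first exact: GG'.
  exact: lt_le_trans tg (gg' _ Gx).
apply: (@le_trans _ _ ((b^-1)%:E * (K1%:E * oint m' G' g'))).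
  by rewrite lee_wpmul2l// lee_fin invr_ge0 ltW.
rewrite !muleA -!EFinM lee_wpmul2r ?oint_ge0// lee_fin.
move: m'm; rewrite mG mG' -EFinM lee_fin => m'm.
rewrite mulrC -mulrA ler_wpM2l ?(ltW K10)// ler_pdivlMr// mulrC ler_pdivrMr//.
Qed.

Lemma le_Av m G g g' : capacity m -> (forall x, G x -> g x <= g' x) ->
  Av m G g <= Av m G g'.
Proof.
move=> cm gg'; have := @le_Av_scale 1 1 m m G G g g' cm cm ltr01 ler01.
by rewrite mulr1 !mul1e; apply=> // A _; rewrite mul1e.
Qed.

Lemma Av_max m G g g1 g2 : capacity m -> subadd2 m ->
  (forall x, G x -> g x <= maxe (g1 x) (g2 x)) -> Av m G g <= Av m G g1 + Av m G g2.
Proof.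
move=> cm sm gle; have [E|[b [b0 mG]] E] := Av_cases G cm; rewrite !E ?adde0//.
rewrite -ge0_muleDr ?oint_ge0// lee_wpmul2l ?lee_fin ?invr_ge0 ?(ltW b0)//.
exact: oint_max.
Qed.

Lemma Av_scale m G g g' (a : R) : capacity m -> (0 < a)%R ->
  (forall x, G x -> g' x <= a%:E * g x) -> Av m G g' <= a%:E * Av m G g.
Proof.
move=> cm a0 gg'; have [E|[b [b0 mG]] E] := Av_cases G cm; rewrite !E ?mule0//.
rewrite muleCA lee_wpmul2l ?lee_fin ?invr_ge0 ?(ltW b0)//.
exact: oint_scale.
Qed.

(** Meant for a measure [m] that is a weighted sum over two pieces: since each weighted piece has
    mass at most [K] times [m G], the mean for [m] is bounded by means normalized on each piece
    separately. *)
Lemma le_Av_add (K a1 a2 : R) m m1 m2 G G1 G2 g :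
  capacity m -> capacity m1 -> capacity m2 -> posfin m1 G1 -> posfin m2 G2 ->
  (0 <= K)%R -> (0 <= a1)%R -> (0 <= a2)%R ->
  (forall A, A `<=` G -> m A <= a1%:E * m1 (A `&` G1) + a2%:E * m2 (A `&` G2)) ->
  a1%:E * m1 G1 <= K%:E * m G -> a2%:E * m2 G2 <= K%:E * m G ->
  Av m G g <= K%:E * (Av m1 G1 g + Av m2 G2 g).
Proof.
move=> cm cm1 cm2 [b1 b10 mG1] [b2 b20 mG2] K0 a10 a20 mle.
have [->|[b [b0 mG]] ->] := Av_cases G cm.
  by rewrite mule_ge0 ?adde_ge0 ?Av_ge0.
rewrite (Av_posfin _ b10 mG1) (Av_posfin _ b20 mG2) mG mG1 mG2 -!EFinM !lee_fin => H1 H2.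
have H : oint m G g <= a1%:E * oint m1 G1 g + a2%:E * oint m2 G2 g.
  apply: le_oint_add => // t t0; apply: le_trans (mle _ _) _; first by move=> x [].
  by apply: leeD; (rewrite lee_wpmul2l ?lee_fin//); [apply: cm1.2|apply: cm2.2];
     move=> x [[_ ?] ?].
have /le_trans : (b^-1)%:E * oint m G g <= (b^-1)%:E * (a1%:E * oint m1 G1 g + a2%:E * oint m2 G2 g).
  by rewrite lee_wpmul2l// lee_fin invr_ge0 ltW.
apply; move: {H} (oint m1 G1 g) (oint m2 G2 g) (oint_ge0 G1 g cm1) (oint_ge0 G2 g cm2).
move=> o1 o2 o10 o20.
rewrite !ge0_muleDr ?mule_ge0 ?lee_fin ?invr_ge0 ?(ltW b10) ?(ltW b20)//.
rewrite !muleA -!EFinM; apply: leeD; rewrite lee_wpmul2r// lee_fin.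
- by rewrite ler_pdivlMr// -mulrA ler_pdivrMl// [leRHS]mulrC.
- by rewrite ler_pdivlMr// -mulrA ler_pdivrMl// [leRHS]mulrC.
Qed.

Lemma le_Ecal (K : R) m G (f : T -> R) (X : \bar R) : (0 < K)%R ->
  (forall c : R, X <= K%:E * Av m G (fun y => (`|f y - c|)%:E)) ->
  X <= K%:E * Ecal m f G.
Proof.
move=> K0 H; rewrite -lee_pdivrMl//; apply/ereal_infP => _ [c _ <-].
by rewrite lee_pdivrMl.
Qed.

Lemma Ecal_le_Av m G (f : T -> R) (c : R) :
  Ecal m f G <= Av m G (fun y => (`|f y - c|)%:E).
Proof. by apply: ereal_inf_lbound; exists c. Qed.

Lemma Ecal_ge0 m G (f : T -> R) : capacity m -> 0 <= Ecal m f G.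
Proof. by move=> cm; apply/ereal_infP => _ [c _ <-]; exact: Av_ge0. Qed.

Lemma le_Ecal_scale (K1 K2 : R) m m' G G' (f : T -> R) : capacity m -> capacity m' ->
  (0 < K1)%R -> (0 < K2)%R -> G `<=` G' ->
  (forall A, A `<=` G -> m A <= K1%:E * m' A) -> m' G' <= K2%:E * m G ->
  Ecal m f G <= (K1 * K2)%:E * Ecal m' f G'.
Proof.
move=> cm cm' K10 K20 GG' mm' m'm; apply: le_Ecal; first exact: mulr_gt0.
move=> c; apply: le_trans (Ecal_le_Av _ _ _ c) _.
by apply: le_Av_scale => //; exact: ltW.
Qed.

(** The factors 2 come from [u + v <= max (2 * u) (2 * v)], which makes [Av_max] applicable. *)
Lemma Av_recenter m G (f : T -> R) (c e : R) : capacity m -> subadd2 m -> m set0 = 0 ->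
  Av m G (fun y => (`|f y - c|)%:E) <=
  2%:E * Av m G (fun y => (`|e - f y|)%:E) + (2 * `|e - c|)%:E.
Proof.
move=> cm sm m0.
apply: le_trans (@Av_max _ _ _ (fun y => (2 * `|e - f y|)%:E) (fun=> (2 * `|e - c|)%:E) cm sm _) _.
  move=> x _; rewrite -EFin_max lee_fin le_max.
  have : (`|f x - c| <= `|e - f x| + `|e - c|)%R.
    by rewrite (distrC e (f x)); apply: le_trans (ler_normD _ _); rewrite addrA subrK.
  case: (leP `|e - f x|%R `|e - c|%R) => ? ?; apply/orP; [right|left]; lra.
apply: leeD; first by apply: Av_scale => // x _; rewrite EFinM.
by apply: Av_le_cst.
Qed.

(* Recenter at [f z] and average the resulting bound over [z] in [G2]. *)
Lemma Av_transfer m1 m2 G1 G2 (f : T -> R) (c : R) :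
  capacity m1 -> subadd2 m1 -> m1 set0 = 0 ->
  capacity m2 -> subadd2 m2 -> posfin m2 G2 ->
  Av m1 G1 (fun y => (`|f y - c|)%:E) <=
  4%:E * Av m2 G2 (fun z => Av m1 G1 (fun y => (`|f z - f y|)%:E)) +
  4%:E * Av m2 G2 (fun z => (`|f z - c|)%:E).
Proof.
move=> cm1 sm1 m10 cm2 sm2 pf2.
pose u z := Av m1 G1 (fun y => (`|f z - f y|)%:E).
set L := Av _ _ _.
(* The sum given by [Av_recenter] is again turned into a maximum, which doubles its factors 2. The
   left side does not depend on [z], so it survives averaging. *)
have key z : L <= maxe (4%:E * u z) (4%:E * (`|f z - c|)%:E).
  have := @Av_recenter m1 G1 f c (f z) cm1 sm1 m10; rewrite -/L -/(u z).
  have : 0 <= u z by exact: Av_ge0.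
  case: (u z) => [w w0|_ _|//].
  - rewrite -!EFinM -EFinD => /le_trans; apply; rewrite -EFin_max lee_fin le_max.
    case: (leP w `|f z - c|%R) => ?; apply/orP; [right|left]; lra.
  - by rewrite gt0_muley ?lte_fin// le_max leey.
apply: (@le_trans _ _ (Av m2 G2 (fun z => maxe (4%:E * u z) (4%:E * (`|f z - c|)%:E)))).
  exact: Av_ge_cst.
apply: le_trans (@Av_max _ _ _ (fun z => 4%:E * u z) (fun z => 4%:E * (`|f z - c|)%:E) cm2 sm2 _) _ => //.
by apply: leeD; apply: Av_scale.
Qed.

(* Hoelder's inequality is not available for non-measurable [f]; instead truncate,
   [a <= max l (l `^ (1 - p) * a `^ p)] for every [l > 0], and optimize in [l]. *)
Lemma Av_powR m G (f : T -> R) (p : R) : capacity m -> subadd2 m -> m set0 = 0 ->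
  (1 < p)%R ->
  Av m G (fun y => (`|f y|)%:E) `^ p <=
  (2 `^ p)%:E * Av m G (fun y => (`|f y|)%:E `^ p).
Proof.
move=> cm sm m0 p1.
have p0 : (0 < p)%R by lra.
set X := Av _ _ _; set Y := Av _ _ _.
have X0 : 0 <= X by exact: Av_ge0.
have Y0 : 0 <= Y by exact: Av_ge0.
have trunc (l : R) : (0 < l)%R -> X <= l%:E + (l `^ (1 - p))%:E * Y.
  move=> l0; rewrite addeC.
  apply: le_trans (@Av_max _ _ _ (fun y => (l `^ (1 - p))%:E * (`|f y|)%:E `^ p) (fun=> l%:E) cm sm _) _.
    move=> x _; rewrite poweR_EFin -EFinM -EFin_max lee_fin le_max.
    have [fl|lf] := leP `|f x|%R l; first by rewrite orbT.
    rewrite orbF.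
    have fx0 : (0 < `|f x|)%R by lra.
    have -> : (l `^ (1 - p) = l / l `^ p)%R.
      by rewrite powRB ?powRr1 ?ltW//; apply/implyP => _; rewrite gt_eqF.
    rewrite mulrAC ler_pdivlMr ?powR_gt0//.
    rewrite -(mulr_powRB1 (ltW fx0) p0) -(mulr_powRB1 (ltW l0) p0).
    rewrite [leRHS]mulrCA ler_wpM2l ?(ltW fx0)// ler_wpM2l ?(ltW l0)//.
    by apply: ge0_ler_powR; rewrite ?nnegrE ?(ltW fx0) ?(ltW lf)//; lra.
  apply: leeD; first by apply: Av_scale => //; rewrite powR_gt0.
  by apply: Av_le_cst => //; exact: ltW.
case: Y Y0 trunc => [y y0 trunc|_ _|//]; last first.
  by rewrite gt0_muley ?leey// lte_fin powR_gt0.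
(* No [l] balances the two terms when [y = 0]; the truncation bound is then used with arbitrarily
   small [l]. *)
have [y0'|yn0] := eqVneq y 0%R.
  have -> : X = 0.
    apply/eqP; rewrite eq_le X0 andbT; apply/lee_addgt0Pr => e e0.
    by rewrite add0e; have := trunc e e0; rewrite y0' mule0 adde0.
  by rewrite poweR0r ?gt_eqF// y0' mule0.
have {y0 yn0} y0 : (0 < y)%R by rewrite lt_neqAle eq_sym yn0.
(* This choice equates the two terms of the truncation bound, giving [X <= 2 * l]. *)
pose l := (y `^ p^-1)%R.
have l0 : (0 < l)%R by rewrite powR_gt0.
have ly : (l `^ p = y)%R by rewrite -powRrM mulVf ?gt_eqF// powRr1// ltW.
have : X <= (2 * l)%:E.
  apply: le_trans (trunc l l0) _; rewrite -EFinM -EFinD lee_fin.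
  have -> : (l `^ (1 - p) * y = l)%R; last lra.
  rewrite -[X in (_ * X)%R]ly -powRD; last by apply/implyP => _; rewrite gt_eqF.
  by rewrite subrK powRr1// ltW.
case: X X0 {trunc} => [x x0 xl|_|//]; last by rewrite leye_eq.
rewrite poweR_EFin -EFinM lee_fin -[y in leRHS]ly.
rewrite -powRM ?(ltW l0)//; apply: ge0_ler_powR; rewrite ?nnegrE ?mulr_ge0 ?(ltW l0) ?(ltW p0)//.
Qed.

End Choquet.

(** * Balls in a doubling space *)

Section Geometry.
Variables (R : realType) (T : Type) (d : T -> T -> R).
Hypothesis dmet : is_metric d.
Local Open Scope ereal_scope.

(** The nontrivial half of the metric outer measure condition. It stands in for Caratheodory
    measurability because for [Haus] it can be read off from covers. *)
Definition gap_superadd (m : set T -> \bar R) := forall (A B : set T) (e : R), (0 < e)%R ->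
  (forall a b, A a -> B b -> (e <= d a b)%R) -> m A + m B <= m (A `|` B).

Lemma distxx x : d x x = 0%R. Proof. exact/dmet.2.1. Qed.

Lemma dist_sym x y : d x y = d y x. Proof. exact: dmet.2.2.1. Qed.

Lemma dist_tri x y z : (d x z <= d x y + d y z)%R. Proof. exact: dmet.2.2.2. Qed.

Lemma cball_sub x y (r s : R) : (d x y + r <= s)%R -> cball d y r `<=` cball d x s.
Proof. by rewrite /cball => H z /= yz; have := dist_tri x y z; lra. Qed.

Lemma dopen_enlarge (A : set T) (e : R) : dopen d [set y | exists2 a, A a & (d a y < e)%R].
Proof.
move=> y [a Aa ay]; exists (e - d a y)%R; split; first by rewrite subr_gt0.
by move=> z /= yz; exists a => //; have := dist_tri a y z; lra.
Qed.

Lemma dopen_cballC x (r : R) : dopen d (~` cball d x r).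
Proof.
move=> y /= /negP; rewrite /cball/= -ltNge => ry; exists (d x y - r)%R.
split; first by rewrite subr_gt0.
move=> z /= yz; apply/negP; rewrite -ltNge.
by have := dist_tri x z y; rewrite (dist_sym z y); lra.
Qed.

Variable mu : set T -> \bar R.
Hypothesis outer_mu : is_outer_measure mu.
Hypothesis borel_mu : borel_regular d mu.

Lemma outer_capacity : capacity mu.
Proof. by have [_ [? [? _]]] := outer_mu. Qed.

Lemma outer_set0 : mu set0 = 0. Proof. by have [] := outer_mu. Qed.

Lemma dopen_cara (U : set T) : dopen d U -> cara mu U.
Proof. by move=> Uo; apply: borel_mu.1; apply: sub_sigma_algebra. Qed.

Lemma cball_cara x (r : R) : cara mu (cball d x r).
Proof.
by move=> B; have := dopen_cara (@dopen_cballC x r) B; rewrite setCK addeC.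
Qed.

Lemma outer_subadd2 : subadd2 mu.
Proof.
move=> A B; have [_ [m0 [_ sub]]] := outer_mu.
have := sub (bigcup2 A B); rewrite bigcup2E => /le_trans; apply.
rewrite (@nneseries_split _ _ 0%N 2%N)//.
rewrite add0n !big_nat_recl//= big_geq// adde0 eseries0 ?adde0//.
by move=> [|[|k]]//= _ _; rewrite /bigcup2/= outer_set0.
Qed.

(** The open [e]-neighbourhood of [A] is Caratheodory measurable, contains [A] and misses [B]. *)
Lemma outer_gap_superadd : gap_superadd mu.
Proof.
move=> A B e e0 AB.
rewrite (dopen_cara (@dopen_enlarge A e) (A `|` B)).
apply: leeD; apply: outer_capacity.2 => x xX.
- by split; [left|exists x => //; rewrite distxx].
- split; first by right.
  by move=> [a Aa ax]; have := AB _ _ Aa xX; rewrite leNgt ax.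
Qed.

Lemma sum_disjoint_cball (I : finType) (P : {set I}) (x : I -> T) (r : I -> R) (A : set T) :
  (forall i j, i != j -> cball d (x i) (r i) `&` cball d (x j) (r j) = set0) ->
  (forall i, i \in P -> cball d (x i) (r i) `<=` A) ->
  \sum_(i in P) mu (cball d (x i) (r i)) <= mu A.
Proof.
move=> disj; have [n] := ubnP #|P|; elim: n P A => // n IH P A cP sub.
have [->|[i iP]] := set_0Vmem P; first by rewrite big_set0 outer_capacity.1.
rewrite (big_setD1 i iP)/= (cball_cara (x i) (r i) A); apply: leeD.
  by apply: outer_capacity.2 => y yi; split=> //; apply: sub yi.
apply: IH => [|j]; first by move: cP; rewrite (cardsD1 i) iP.
rewrite !inE => /andP[ji jP] y yj; split; first exact: sub yj.
by move=> yi; have := disj _ _ ji; rewrite -subset0; apply; split; [exact: yj|exact: yi].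
Qed.

Lemma sum_disjoint_cball_all (I : finType) (x : I -> T) (r : I -> R) (A : set T) :
  (forall i j, i != j -> cball d (x i) (r i) `&` cball d (x j) (r j) = set0) ->
  (forall i, cball d (x i) (r i) `<=` A) ->
  \sum_i mu (cball d (x i) (r i)) <= mu A.
Proof.
move=> disj sub; rewrite (eq_bigl (fun i => i \in [set: I]%SET)); last by move=> i; rewrite finset.in_setT.
by apply: sum_disjoint_cball => // i _; exact: sub.
Qed.

Hypothesis locfin_mu : locally_finite d mu.
Hypothesis supp_mu : supp d mu = setT.
Hypothesis doubling_mu : unif_loc_doubling d mu.

Lemma doubling_pow (Rad : R) (n : nat) : (0 < Rad)%R -> exists2 C : R, (0 < C)%R &
  forall x (r : R), (0 < r <= Rad)%R -> mu (cball d x (2 ^+ n * r)) <= C%:E * mu (cball d x r).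
Proof.
move=> Rad0; have Rn0 : (0 < 2 ^+ n * Rad)%R by rewrite mulr_gt0 ?exprn_gt0.
have [C HC] := doubling_mu Rn0.
(* The constant supplied by the doubling condition has no prescribed sign. *)
pose C' := (`|C| + 1)%R.
have C'0 : (0 < C')%R by rewrite /C'; have := normr_ge0 C; lra.
exists (C' ^+ n)%R; first by rewrite exprn_gt0.
move=> x r /andP[r0 rRad].
have : (n <= n)%N by []; move: {1 3 4}n.
elim=> [|k IH] kn; first by rewrite expr0 !mul1r mul1e.
have kr0 : (0 < 2 ^+ k * r)%R by rewrite mulr_gt0// exprn_gt0.
rewrite exprS -mulrA; apply: le_trans (HC _ _ _) _.
  rewrite kr0/= ler_pM// ?exprn_ge0 ?(ltW r0)//.
  by rewrite ler_weXn2l ?ler1n// ltnW.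
apply: (@le_trans _ _ (C'%:E * mu (cball d x (2 ^+ k * r)))).
  rewrite lee_wpmul2r ?outer_capacity.1// lee_fin /C'.
  by have := ler_norm C; lra.
by rewrite exprS EFinM -muleA lee_wpmul2l ?IH ?lee_fin ?(ltW C'0)// ltnW.
Qed.

Lemma two_pow_gt (L : R) : exists n : nat, (L <= 2 ^+ n)%R.
Proof.
exists (Num.truncn `|L|).+1.
have := truncnS_gt `|L|%R; set n := (Num.truncn _).+1 => Ln.
apply: le_trans (ler_norm L) (le_trans (ltW Ln) _).
by rewrite -natrX ler_nat ltnW// ltn_expl.
Qed.

(** Local finiteness gives one ball of finite mass about [x]; iterated doubling carries finiteness
    to every radius. *)
Lemma ball_posfin x (r : R) : (0 < r)%R -> posfin mu (cball d x r).
Proof.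
move=> r0; have [s [s0 sfin]] := locfin_mu x.
have [n Hn] := two_pow_gt (r / s).
have [C C0 HC] := doubling_pow n s0.
have sx : (0 < s <= s)%R by rewrite s0 lexx.
have lt : mu (cball d x r) < +oo.
  apply: (@le_lt_trans _ _ (C%:E * mu (cball d x s))).
    apply: le_trans (HC x s sx); apply: outer_capacity.2; apply: cball_sub.
    by rewrite distxx add0r -ler_pdivrMr.
  by apply: lte_mul_pinfty => //; rewrite lee_fin ltW.
have gt : 0 < mu (cball d x r).
  by have : supp d mu x; [rewrite supp_mu|exact].
rewrite /posfin; move: lt gt; case: (mu _) => [b||]//= _; rewrite lte_fin => b0.
by exists b.
Qed.

Lemma doubling_gen (L Rad : R) : (0 < L)%R -> (0 < Rad)%R -> exists2 C : R, (0 < C)%R &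
  forall x y (r s : R), (0 < r <= Rad)%R -> (s <= L * r)%R -> (d x y <= L * r)%R ->
  mu (cball d y s) <= C%:E * mu (cball d x r).
Proof.
move=> L0 Rad0; have [n Hn] := two_pow_gt (2 * L).
have [C C0 HC] := doubling_pow n Rad0; exists C => // x y r s rR sL dL.
apply: le_trans (HC x r rR); apply: outer_capacity.2; apply: cball_sub.
apply: (@le_trans _ _ (2 * L * r)%R); first lra.
by rewrite ler_wpM2r//; case/andP: rR => /ltW.
Qed.

End Geometry.

(** * Codimensional Hausdorff measures *)

Section Hausdorff.
Variables (R : realType) (T : Type) (d : T -> T -> R).
Hypothesis dmet : is_metric d.
Local Open Scope ereal_scope.

Lemma le_ereal_infD (S1 S2 : set (\bar R)) (X : \bar R) :
  (forall s, S1 s -> 0 <= s) -> (forall s, S2 s -> 0 <= s) ->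
  (forall s1 s2, S1 s1 -> S2 s2 -> X <= s1 + s2) -> X <= ereal_inf S1 + ereal_inf S2.
Proof.
move=> S10 S20 H.
have i10 : 0 <= ereal_inf S1 by apply/ereal_infP.
have i20 : 0 <= ereal_inf S2 by apply/ereal_infP.
have [fin1|] := boolP (ereal_inf S1 \is a fin_num); last first.
  by rewrite ge0_fin_numE// -leNgt leye_eq => /eqP ->; rewrite addye ?leey// gt_eqF// (lt_le_trans _ i20).
have [fin2|] := boolP (ereal_inf S2 \is a fin_num); last first.
  by rewrite ge0_fin_numE// -leNgt leye_eq => /eqP ->; rewrite addey ?leey// gt_eqF// (lt_le_trans _ i10).
apply/lee_addgt0Pr => e e0.
have e20 : (0 < e / 2)%R by rewrite divr_gt0.
have [s1 S1s1 s1lt] := lb_ereal_inf_adherent e20 fin1.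
have [s2 S2s2 s2lt] := lb_ereal_inf_adherent e20 fin2.
apply: le_trans (H _ _ S1s1 S2s2) _.
apply: le_trans (leeD (ltW s1lt) (ltW s2lt)) _.
by rewrite addeACA -EFinD -splitr.
Qed.

Lemma ge_ereal_supD (S1 S2 : set (\bar R)) (X : \bar R) : S1 !=set0 -> S2 !=set0 ->
  (forall s, S1 s -> 0 <= s) -> (forall s, S2 s -> 0 <= s) ->
  (forall s1 s2, S1 s1 -> S2 s2 -> s1 + s2 <= X) -> ereal_sup S1 + ereal_sup S2 <= X.
Proof.
move=> [a1 S1a] [a2 S2a] S10 S20 H.
have X0 : 0 <= X.
  by apply: le_trans (H _ _ S1a S2a); apply: adde_ge0; [exact: S10|exact: S20].
move: X X0 H => [X X0 H|_ _|]//; first last.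
  by rewrite leey.
have fin1 s : S1 s -> s \is a fin_num.
  move=> Ss; rewrite ge0_fin_numE ?S10//; apply: le_lt_trans (ltry X).
  by apply: le_trans (H _ _ Ss S2a); rewrite leeDl ?S20.
have s2X : ereal_sup S2 <= X%:E.
  by apply/ereal_supP => s Ss; apply: le_trans (H _ _ S1a Ss); rewrite leeDr ?S10.
have fin2 : ereal_sup S2 \is a fin_num.
  rewrite ge0_fin_numE; first exact: le_lt_trans s2X (ltry _).
  by apply: le_trans (S20 _ S2a) _; exact: ereal_sup_ubound.
rewrite -leeBrDr//; apply/ereal_supP => s Ss.
rewrite leeBrDr// addeC -leeBrDr ?fin1//; apply/ereal_supP => s' Ss'.
by rewrite leeBrDr ?fin1// addeC; exact: H.
Qed.

Variable mu : set T -> \bar R.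
Hypothesis cap_mu : capacity mu.
Variable th : R.

Local Notation weight x r := (mu (cball d x r) * (r `^ (- th))%:E).

Lemma weight_ge0 x (r : R) : 0 <= weight x r.
Proof. by rewrite mule_ge0 ?cap_mu.1// lee_fin powR_ge0. Qed.

Lemma Hdelta_le (delta : R) (E : set T) (I : set nat) (x : nat -> T) (r : nat -> R) :
  (forall i, I i -> (0 < r i < delta)%R) ->
  E `<=` \bigcup_(i in I) cball d (x i) (r i) ->
  Hdelta d mu th delta E <= \esum_(i in I) weight (x i) (r i).
Proof. by move=> ? ?; apply: ereal_inf_lbound; exists I, x, r. Qed.

Lemma Hdelta_ge0 (delta : R) (E : set T) : 0 <= Hdelta d mu th delta E.
Proof.
apply/ereal_infP => _ [I [x [r [_ [_ ->]]]]]; apply: esum_ge0 => i _.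
exact: weight_ge0.
Qed.

Lemma Hdelta_mono (delta : R) (A B : set T) : A `<=` B ->
  Hdelta d mu th delta A <= Hdelta d mu th delta B.
Proof.
move=> AB; apply/ereal_infP => _ [I [x [r [rd [cov ->]]]]].
by apply: Hdelta_le => //; exact: subset_trans cov.
Qed.

Lemma Hdelta_anti (delta delta' : R) (E : set T) : (delta <= delta')%R ->
  Hdelta d mu th delta' E <= Hdelta d mu th delta E.
Proof.
move=> dd'; apply/ereal_infP => _ [I [x [r [rd [cov ->]]]]].
apply: Hdelta_le => // i Ii; have /andP[-> rlt] := rd _ Ii.
exact: lt_le_trans rlt dd'.
Qed.

Lemma Haus_ge (delta : R) (E : set T) : (0 < delta)%R ->
  Hdelta d mu th delta E <= Haus d mu th E.
Proof. by move=> d0; apply: ereal_sup_ubound; exists delta. Qed.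

Lemma Haus_capacity : capacity (Haus d mu th).
Proof.
split=> [A|A B AB].
  exact: le_trans (Hdelta_ge0 1 A) (Haus_ge _ ltr01).
apply/ereal_supP => _ [e /= e0 <-].
exact: le_trans (Hdelta_mono _ AB) (Haus_ge _ e0).
Qed.

(* On an empty space there are no centres, hence no covers, and [Haus set0 = +oo]. *)
Lemma Haus_set0 : inhabited T -> Haus d mu th set0 = 0.
Proof.
move=> [t]; apply/eqP; rewrite eq_le Haus_capacity.1 andbT.
apply/ereal_supP => _ [e /= e0 <-].
rewrite -(@esum_set0 _ nat (fun i => weight ((fun=> t) i) ((fun=> 1%R) i))).
exact: Hdelta_le.
Qed.

Lemma Hdelta_subadd2 (delta : R) : subadd2 (Hdelta d mu th delta).
Proof.
move=> A B; apply: le_ereal_infD.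
- by move=> _ [I [x [r [_ [_ ->]]]]]; apply: esum_ge0 => i _; exact: weight_ge0.
- by move=> _ [I [x [r [_ [_ ->]]]]]; apply: esum_ge0 => i _; exact: weight_ge0.
move=> _ _ [I1 [x1 [r1 [rd1 [cov1 ->]]]]] [I2 [x2 [r2 [rd2 [cov2 ->]]]]].
(* The two covers are interleaved: the first on even indices, the second on odd ones. *)
pose I := [set n | if odd n then I2 n./2 else I1 n./2].
pose x n := if odd n then x2 n./2 else x1 n./2.
pose r n := if odd n then r2 n./2 else r1 n./2.
have -> : \esum_(i in I1) weight (x1 i) (r1 i) + \esum_(i in I2) weight (x2 i) (r2 i)
   = \esum_(i in I) weight (x i) (r i).
  rewrite (esumID [set n | ~~ odd n] I); last by move=> i _; exact: weight_ge0.
  congr (_ + _).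
  - rewrite [RHS](@reindex_esum _ _ _ I1 _ double).
      by apply: eq_esum => i _; rewrite /x /r odd_double doubleK.
    split=> [n I1n|m n _ _ /double_inj//|n [] In /= nodd].
      by rewrite /I/= odd_double doubleK.
    exists n./2; last by rewrite halfK (negbTE nodd) subn0.
    by move: In; rewrite /I/= (negbTE nodd).
  - rewrite [RHS](@reindex_esum _ _ _ I2 _ (fun n => n.*2.+1)).
      by apply: eq_esum => i _; rewrite /x /r /= odd_double/= uphalf_double.
    split=> [n I2n|m n _ _ [/double_inj]//|n [] In /= /negP].
      by rewrite /I/= odd_double/= uphalf_double; split=> //; exact/negP/negPn.
    rewrite negbK => nodd; exists n./2; first by move: In; rewrite /I/= nodd.
    by rewrite halfK nodd subn1 prednK//; case: n nodd {In}.
apply: Hdelta_le => [n|t [At|Bt]].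
- by rewrite /I /r/=; case: ifP => _; [exact: rd2|exact: rd1].
- have [n I1n tn] := cov1 _ At; exists n.*2; first by rewrite /I/= odd_double doubleK.
  by rewrite /x /r odd_double doubleK.
- have [n I2n tn] := cov2 _ Bt; exists n.*2.+1; first by rewrite /I/= odd_double/= uphalf_double.
  by rewrite /x /r/= odd_double/= uphalf_double.
Qed.

Lemma Haus_subadd2 : subadd2 (Haus d mu th).
Proof.
move=> A B; apply/ereal_supP => _ [e /= e0 <-].
by apply: le_trans (Hdelta_subadd2 _ _ _) _; apply: leeD; exact: Haus_ge.
Qed.

(** A ball of radius below [delta] has diameter below [e], so it meets at most one of [A] and [B],
    and every cover of the union splits. *)
Lemma Hdelta_gap (A B : set T) (delta e : R) : (2 * delta <= e)%R ->
  (forall a b, A a -> B b -> (e <= d a b)%R) ->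
  Hdelta d mu th delta A + Hdelta d mu th delta B <= Hdelta d mu th delta (A `|` B).
Proof.
move=> de gap; apply/ereal_infP => _ [I [x [r [rd [cov ->]]]]].
pose J := [set i | exists2 a, A a & cball d (x i) (r i) a].
rewrite (esumID J I); last by move=> i _; exact: weight_ge0.
apply: leeD; apply: Hdelta_le => [i [Ii _]|t tX]; try exact: rd.
- have [i Ii ti] := cov t (or_introl tX).
  by exists i => //; split=> //; exists t.
- have [i Ii ti] := cov t (or_intror tX).
  exists i => //; split=> // -[a Aa ai].
  have := gap _ _ Aa tX; have /andP[_] := rd _ Ii.
  have := dist_tri dmet a (x i) t; rewrite (dist_sym dmet a (x i)).
  by move: ti ai; rewrite /cball/=; lra.
Qed.

Lemma Haus_gap_superadd : gap_superadd d (Haus d mu th).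
Proof.
move=> A B e e0 gap; apply: ge_ereal_supD.
- by exists (Hdelta d mu th 1 A); exists 1%R => //=.
- by exists (Hdelta d mu th 1 B); exists 1%R => //=.
- by move=> _ [? _ <-]; exact: Hdelta_ge0.
- by move=> _ [? _ <-]; exact: Hdelta_ge0.
move=> _ _ [d1 /= d10 <-] [d2 /= d20 <-].
pose dl := Num.min (Num.min d1 d2) (e / 2)%R.
have dl0 : (0 < dl)%R by rewrite !lt_min d10 d20 divr_gt0.
apply: le_trans (Haus_ge _ dl0).
apply: (@le_trans _ _ (Hdelta d mu th dl A + Hdelta d mu th dl B)).
  by apply: leeD; apply: Hdelta_anti; rewrite !ge_min lexx ?orbT.
apply: Hdelta_gap gap.
have : (dl <= e / 2)%R by rewrite ge_min lexx orbT.
by lra.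
Qed.

End Hausdorff.

(** * Comparison of [mu] with its Hausdorff measure of codimension zero *)

Section HausdorffZero.
Variables (R : realType) (T : Type) (d : T -> T -> R).
Hypothesis dmet : is_metric d.
Variable mu : set T -> \bar R.
Hypothesis outer_mu : is_outer_measure mu.
Hypothesis borel_mu : borel_regular d mu.
Hypothesis locfin_mu : locally_finite d mu.
Hypothesis supp_mu : supp d mu = setT.
Hypothesis doubling_mu : unif_loc_doubling d mu.
Local Open Scope ereal_scope.

Let cap_mu := outer_capacity outer_mu.

(** For [th = 0] the weights are the masses of the balls, so countable subadditivity bounds [mu E]
    by the cost of any cover. *)
Lemma mu_le_Haus0 (E : set T) : mu E <= Haus d mu 0 E.
Proof.
apply: le_trans (Haus_ge d mu 0 E ltr01).
apply/ereal_infP => _ [I [x [r [_ [cov ->]]]]].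
pose F n := if n \in I then cball d (x n) (r n) else set0.
apply: (@le_trans _ _ (mu (\bigcup_n F n))).
  apply: cap_mu.2 => t /cov[n In tn]; exists n => //.
  by rewrite /F mem_set.
have [_ [_ [_ sub]]] := outer_mu; apply: le_trans (sub F) _.
rewrite nneseries_esumT; last by move=> n; exact: cap_mu.1.
rewrite [leRHS]esum_mkcond; apply: le_esum => n _; rewrite /F.
by case: ifP => _; rewrite ?(outer_set0 outer_mu)// oppr0 powRr0 mule1.
Qed.

Definition enlarge (E : set T) (e : R) := [set y | exists2 a, E a & (d a y < e)%R].

Lemma enlarge_sub (E : set T) (e e' : R) : (e <= e')%R -> enlarge E e `<=` enlarge E e'.
Proof. by move=> ee' y [a Ea ay]; exists a => //; exact: lt_le_trans ay ee'. Qed.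

(** Outer regularity along metric neighbourhoods. The shells between consecutive neighbourhoods of
    radii [1 / n.+1] have summable mass, as the first neighbourhood lies in a ball, and a tail of
    this series bounds what is added to [E]. Closedness makes the neighbourhoods shrink to [E]. *)
Lemma mu_enlarge (E : set T) x (r e : R) : dclosed d E -> E `<=` cball d x r -> (0 < e)%R ->
  exists2 s : R, (0 < s)%R & forall s', (s' <= s)%R -> mu (enlarge E s') <= mu E + e%:E.
Proof.
move=> Ecl Er e0.
pose U n := enlarge E (n.+1%:R^-1).
pose D n := U n `\` U n.+1.
have U_dec n : U n.+1 `<=` U n.
  by apply: enlarge_sub; rewrite lef_pV2 ?posrE// ler_nat.
have U0fin : mu (U 0%N) < +oo.
  have r10 : (0 < `|r| + 1)%R by have := normr_ge0 r; lra.
  have [b _ mb] := ball_posfin dmet outer_mu locfin_mu supp_mu doubling_mu x r10.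
  apply: le_lt_trans (ltry b); rewrite -mb; apply: cap_mu.2 => y [a /Er].
  rewrite /cball/= invr1; have := dist_tri dmet x a y; have := ler_norm r; lra.
have UD n : \sum_(0 <= k < n) mu (D k) + mu (U n) = mu (U 0%N).
  elim: n => [|n <-]; first by rewrite big_geq// add0e.
  rewrite big_nat_recr//= -addeA; congr (_ + _).
  rewrite [RHS](dopen_cara borel_mu (@dopen_enlarge _ _ _ dmet E (n.+2%:R^-1)%R)) addeC.
  congr (_ + _); congr mu; apply/esym/setIidPr; exact: U_dec.
have Dfin : \sum_(0 <= k <oo) mu (D k) < +oo.
  apply: le_lt_trans U0fin.
  apply: lime_le; first by apply: is_cvg_nneseries => n _ _; exact: cap_mu.1.
  by apply: nearW => n; rewrite -(UD n) leeDl ?cap_mu.1.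
have /fine_cvgP[_ /cvgrPdist_lt /(_ _ e0)] := nneseries_tail_cvg Dfin (fun k _ => cap_mu.1 (D k)).
move=> [N _ /(_ N (leqnn N))] tailN.
exists (N.+1%:R^-1)%R => [|s' s'N]; first by rewrite invr_gt0.
apply: (@le_trans _ _ (mu (U N))); first by apply: cap_mu.2; exact: enlarge_sub.
(* A point outside [E] lies in the shell just before the first neighbourhood that omits it. *)
have cov : U N `<=` E `|` \bigcup_n D (n + N)%N.
  move=> y yN; have [yE|nyE] := pselect (E y); [by left|right].
  have [n yn] : exists n, ~ U n y.
    apply: contrapT => H; apply: nyE; apply: Ecl => q q0.
    have [n nq] : exists n : nat, (n.+1%:R^-1 < q)%R.
      exists (Num.truncn q^-1); rewrite invf_plt ?posrE//; exact: truncnS_gt.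
    have [a Ea ay] : U n y by apply: contrapT => nU; apply: H; exists n.
    by exists a; split=> //; rewrite (dist_sym dmet); exact: lt_trans ay nq.
  have exP : exists n, `[< ~ U n y >] by exists n; apply/asboolP.
  case: (ex_minnP exP) => -[|m] /asboolP nUm mmin.
    by exfalso; apply: nUm; move: yN; elim: (N) => // k IH /U_dec.
  have Um : U m y.
    apply: contrapT => nU; have := mmin m; rewrite ltnn => H.
    by have := H (asboolT nU).
  have [Nm|mN] := leqP N m; first by exists (m - N)%N => //; rewrite subnK.
  exfalso; apply: nUm; move: yN; rewrite -(subnK mN); elim: (_ - _)%N => // k IH /U_dec.
  exact: IH.
apply: le_trans (cap_mu.2 _ _ cov) _.
apply: le_trans (outer_subadd2 outer_mu _ _) _; apply: leeD => //.
have [_ [_ [_ sub]]] := outer_mu; apply: le_trans (sub _) _.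
rewrite (@nneseries_addn _ (mu \o D) N); last by move=> k; exact: cap_mu.1.
move: tailN => /=; rewrite sub0r normrN => tailN.
have tail0 : 0 <= \sum_(N <= k <oo) mu (D k) by apply: nneseries_ge0 => k _ _; exact: cap_mu.1.
have tailfin : \sum_(N <= k <oo) mu (D k) \is a fin_num.
  rewrite ge0_fin_numE//; apply: le_lt_trans Dfin.
  rewrite [leRHS](@nneseries_split _ _ 0%N N); last by move=> k _; exact: cap_mu.1.
  by rewrite add0n leeDr// sume_ge0// => k _; exact: cap_mu.1.
rewrite -(fineK tailfin) lee_fin; apply: le_trans (ler_norm _) _; exact: ltW.
Qed.

(** A maximal [s]-separated subset of [E] is a net. A maximal one exists because the disjoint balls
    of radius [s / 2] about its points lie in one ball of mass [b] and have mass at least [b / C]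
    each, so there are at most [C] points. *)
Lemma finite_net (E : set T) x (r s : R) : E `<=` cball d x r -> (0 < s <= 1)%R ->
  exists n (z : nat -> T), [/\ forall i, (i < n)%N -> E (z i),
    forall i j, (i < j < n)%N -> (s < d (z i) (z j))%R &
    E `<=` \bigcup_(i in `I_n) cball d (z i) s].
Proof.
move=> Er /andP[s0 s1].
pose sep n (z : nat -> T) := (forall i, (i < n)%N -> E (z i)) /\
  (forall i j, (i < j < n)%N -> (s < d (z i) (z j))%R).
pose r' : R := (`|r| + 1)%R.
have r'0 : (0 < r')%R by rewrite /r'; have := normr_ge0 r; lra.
have s20 : (0 < s / 2)%R by rewrite divr_gt0.
have L0 : (0 < 2 * r' / s)%R by rewrite !divr_gt0// mulr_gt0.
have [C C0 HC] := doubling_gen dmet outer_mu doubling_mu L0 s20.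
have [b b0 mb] := ball_posfin dmet outer_mu locfin_mu supp_mu doubling_mu x r'0.
have bnd n : `[< exists z, sep n z >] -> (n <= Num.truncn C)%N.
  move=> /asboolP[z [zE zs]].
  have zs' (i j : 'I_n) : i != j -> (s < d (z i) (z j))%R.
    move=> ij; have [lt|gt|eq] := ltngtP i j.
    - by apply: zs; rewrite lt ltn_ord.
    - by rewrite (dist_sym dmet); apply: zs; rewrite gt ltn_ord.
    - by move/eqP: ij => /(_ (val_inj eq)).
  have : \sum_(i < n) mu (cball d (z i) (s / 2)) <= mu (cball d x r').
    apply: (sum_disjoint_cball_all dmet outer_mu borel_mu) => [i j ij|i].
      apply/seteqP; split=> // y [/= y1 y2]; have := zs' _ _ ij.
      have := dist_tri dmet (z i) y (z j); rewrite (dist_sym dmet y (z j)).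
      by move: y1 y2; rewrite /cball/=; lra.
    apply: cball_sub => //; have := Er _ (zE i (ltn_ord i)); rewrite /cball/= /r'.
    by have := ler_norm r; lra.
  have low (i : 'I_n) : (b / C)%:E <= mu (cball d (z i) (s / 2)).
    have rE : (2 * r' / s * (s / 2) = r')%R by field; rewrite gt_eqF.
    rewrite mulrC EFinM lee_pdivrMl// -mb; apply: HC; rewrite ?rE ?s20 ?lexx//.
    rewrite (dist_sym dmet); have := Er _ (zE i (ltn_ord i)); rewrite /cball/= /r'.
    by have := ler_norm r; lra.
  move=> /(le_trans (lee_sum _ (fun i _ => low i))).
  rewrite sumEFin mb lee_fin sumr_const card_ord => H.
  have nC : (n%:R <= C)%R.
    have {}H : (n%:R * (b / C) <= b)%R by rewrite mulr_natl.
    by move: H; rewrite mulrA ler_pdivrMr// [(b * C)%R]mulrC ler_pM2r.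
  by rewrite truncn_ge_nat// ltW.
have ex0 : exists n, `[< exists z, sep n z >].
  exists 0%N; apply/asboolP; exists (fun=> x); split=> // i j.
  by rewrite ltn0 andbF.
case: (ex_maxnP ex0 bnd) => n /asboolP[z [zE zs]] nmax.
exists n, z; split=> // y Ey; apply: contrapT => ny.
pose z' i := if (i < n)%N then z i else y.
have : (n.+1 <= n)%N.
  apply: nmax; apply/asboolP; exists z'; split=> [i|i j /andP[ij jn]].
    by move=> _; rewrite /z'; case: ltnP => [/zE|].
  rewrite /z'; have iln : (i < n)%N by apply: leq_trans ij _.
  rewrite iln; case: ltnP => [jln|nj]; first by apply: zs; rewrite ij jln.
  by rewrite ltNge; apply/negP => H; apply: ny; exists i.
by rewrite ltnn.
Qed.

(** Balls of radius [s] about an [s]-separated net form an admissible cover. Halving the radii costs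
    the factor [C] and makes the balls disjoint inside a neighbourhood of [E] whose mass barely
    exceeds [mu E]. *)
Lemma Haus0_le : exists2 C : R, (0 < C)%R & forall (E : set T) x (r : R),
  dclosed d E -> E `<=` cball d x r -> Haus d mu 0 E <= C%:E * mu E.
Proof.
have [C C0 HC] := doubling_gen dmet outer_mu doubling_mu (@ltr0n R 2) ltr01.
exists C => // E x r Ecl Er; apply/ereal_supP => _ [dl /= dl0 <-].
have step e : (0 < e)%R -> Hdelta d mu 0 dl E <= C%:E * (mu E + e%:E).
  move=> e0; have [s0 s00 Hs0] := mu_enlarge Ecl Er e0.
  pose s := (Num.min (Num.min s0 1) (dl / 2))%R.
  have s00' : (0 < s)%R by rewrite !lt_min s00 ltr01 divr_gt0.
  have s1 : (s <= 1)%R by rewrite !ge_min lexx !orbT.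
  have sd : (s < dl)%R.
    have : (s <= dl / 2)%R by rewrite !ge_min lexx !orbT.
    by lra.
  have ss0 : (s <= s0)%R by rewrite !ge_min lexx.
  have [n [z [zE zs cov]]] : exists n (z : nat -> T), [/\ forall i, (i < n)%N -> E (z i),
    forall i j, (i < j < n)%N -> (s < d (z i) (z j))%R &
    E `<=` \bigcup_(i in `I_n) cball d (z i) s].
    by apply: finite_net Er _; rewrite s00'.
  apply: le_trans (@Hdelta_le _ _ d mu 0 dl E `I_n z (fun=> s) _ cov) _.
    by move=> i _; rewrite s00' sd.
  rewrite esum_fset//; last by move=> i _; exact: weight_ge0.
  rewrite -fsbig_ord oppr0 powRr0.
  apply: (@le_trans _ _ (\sum_(i < n) C%:E * mu (cball d (z i) (s / 2)))).
    apply: lee_sum => i _; rewrite mule1; apply: HC.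
    - by apply/andP; split; lra.
    - lra.
    - by rewrite distxx//; lra.
  rewrite -ge0_sume_distrr; last by move=> i _; exact: cap_mu.1.
  rewrite lee_wpmul2l ?lee_fin ?(ltW C0)//.
  apply: le_trans (Hs0 s ss0).
  apply: (sum_disjoint_cball_all dmet outer_mu borel_mu) => [i j ij|i y].
    have zs' : (s < d (z i) (z j))%R.
      have [lt|gt|eq] := ltngtP i j.
      - by apply: zs; rewrite lt ltn_ord.
      - by rewrite (dist_sym dmet); apply: zs; rewrite gt ltn_ord.
      - by move/eqP: ij => /(_ (val_inj eq)).
    apply/seteqP; split=> // y [/= y1 y2]; move: zs'.
    have := dist_tri dmet (z i) y (z j); rewrite (dist_sym dmet y (z j)).
    by move: y1 y2; rewrite /cball/=; lra.
  rewrite /cball/= => yi; exists (z i); first exact: zE.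
  by lra.
apply/lee_addgt0Pr => e e0.
have eC : (0 < e / C)%R by rewrite divr_gt0.
apply: le_trans (step _ eC) _.
rewrite ge0_muleDr ?cap_mu.1 ?lee_fin ?(ltW eC)// -EFinM mulrC divfK// gt_eqF//.
Qed.

(** Regularity of [S1] is stated for [Haus d mu 0], whereas [mk_seq] and [fsharp] weigh [S1] by
    [mu]. The trace of [S1] on a closed ball is closed and bounded, so [Haus0_le] applies to it. *)
Lemma ADR0_lower (S1 : set T) : ADR d mu 0 S1 -> exists2 C : R, (0 < C)%R &
  forall y (r : R), S1 y -> (0 < r <= 1)%R ->
    mu (cball d y r) <= C%:E * mu (cball d y r `&` S1).
Proof.
move=> [S1cl [k1 [k2 [k10 [_ H]]]]]; have [C C0 HC] := Haus0_le.
exists (C / k1)%R; first by rewrite divr_gt0.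
move=> y r yS r1; have [lo _] := H y r yS r1.
rewrite mulrC EFinM -muleA lee_pdivlMl//.
move: lo; rewrite oppr0 powRr0 mulr1 => /le_trans; apply.
apply: (HC _ y r); last by move=> z [].
move=> z Hz; split.
  rewrite /cball/=; apply/ler_addgt0Pr => e e0.
  have [w [[yw _] zw]] := Hz e e0; move: yw; rewrite /cball/=.
  by have := dist_tri dmet y w z; rewrite (dist_sym dmet w z); lra.
by apply: S1cl => e e0; have [w [[_ ?] ?]] := Hz e e0; exists w.
Qed.

End HausdorffZero.

(** * Covering arguments *)

Section Covering.
Variables (R : realType) (T : Type) (d : T -> T -> R).
Hypothesis dmet : is_metric d.
Variable mu : set T -> \bar R.
Hypothesis outer_mu : is_outer_measure mu.
Hypothesis borel_mu : borel_regular d mu.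
Hypothesis locfin_mu : locally_finite d mu.
Hypothesis supp_mu : supp d mu = setT.
Hypothesis doubling_mu : unif_loc_doubling d mu.
Local Open Scope ereal_scope.

Let cap_mu := outer_capacity outer_mu.

Lemma sum_oint_le (I : finType) (P : {set I}) (K : R) (m : I -> set T -> \bar R)
    (G : I -> set T) (g : I -> T -> \bar R) (m' : set T -> \bar R) (G' : set T)
    (g' : T -> \bar R) : (forall i, capacity (m i)) -> capacity m' -> (0 <= K)%R ->
  (forall t : R, (0 <= t)%R ->
     \sum_(i in P) layer (m i) (G i) (g i) t <= K%:E * layer m' G' g' t) ->
  \sum_(i in P) oint (m i) (G i) (g i) <= K%:E * oint m' G' g'.
Proof.
move=> cm cm' K0 H; have mn := @measurable_nneg_reals R.
rewrite ointE -big_enum/=; under eq_bigr do rewrite ointE.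
rewrite -ge0_integral_sum//; last 2 first.
- by move=> i; exact: measurable_layer.
- by move=> i t _; exact: (cm i).1.
rewrite -ge0_integralZl_EFin//; last 2 first.
- by move=> t _; exact: cm'.1.
- exact: measurable_layer.
apply: ge0_le_integral => //.
- by move=> t _; apply: sume_ge0 => i _; exact: (cm i).1.
- by apply: emeasurable_sum => i; exact: measurable_layer.
- apply: antitone_measurable => // s t st.
  by apply: lee_wpmul2l; rewrite ?lee_fin//; exact: layer_anti.
- by move=> t t0; rewrite big_enum/=; exact: H.
Qed.

Definition disjoint_balls (I : finType) (x : I -> T) (r : I -> R) :=
  forall i j, i != j -> cball d (x i) (r i) `&` cball d (x j) (r j) = set0.

(* Vitali selection: a ball of largest radius absorbs all the balls it conflicts with,
   and the dilates of the remaining ones stay at positive distance from its own. *)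
Lemma vitali_sum (K : R) : (1 <= K)%R -> exists2 C : R, (0 < C)%R &
  forall (I : finType) (x : I -> T) (r : I -> R) (nu : set T -> \bar R) (S' : set T) (D : R)
    (P : {set I}) (A : set T),
  disjoint_balls x r -> (forall i, 0 < r i <= 1)%R -> capacity nu -> gap_superadd d nu ->
  (0 <= D)%R ->
  (forall i, i \in P -> mu (cball d (x i) (r i)) <= D%:E * nu (cball d (x i) (K * r i) `&` S')) ->
  (forall i, i \in P -> cball d (x i) (K * r i) `&` S' `<=` A) ->
  \sum_(i in P) mu (cball d (x i) (r i)) <= (C * D)%:E * nu A.
Proof.
move=> K1; have K50 : (0 < 5 * K)%R by lra.
have [C C0 HC] := doubling_gen dmet outer_mu doubling_mu K50 ltr01.
exists C => // I x r nu S' D P A disj r01 cn gn D0.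
have CD0 : (0 <= C * D)%R by rewrite mulr_ge0// ltW.
have [n] := ubnP #|P|; elim: n P A => // n IH P A cP muD sub.
have [->|[i1 i1P]] := set_0Vmem P.
  by rewrite big_set0 mule_ge0 ?cn.1.
case: (@Order.TotalTheory.arg_maxP _ _ _ i1 (mem P) r i1P) => i0 i0P' i0max.
have {i0P'} i0P : i0 \in P by [].
(* Balls in [N] have centres within [4 * K * r i0] of [x i0] and radii at most [K * r i0], whence
   the factor [5 * K]. For the others the threshold is twice the sum of the dilated radii, so the
   dilates stay at distance at least [K * r i0]. *)
pose N := [set i in P | (d (x i0) (x i) <= 2 * K * (r i + r i0))%R]%SET.
rewrite (big_setID N)/=.
(* The induction hypothesis is used with this set instead of [A]: it is the one known to be far from
   the dilated ball of [i0]. *)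
set A' := \bigcup_(i in [set i | i \in P :\: N]) (cball d (x i) (K * r i) `&` S').
have /andP[r00 r01'] := r01 i0.
have H1 : \sum_(i in P :&: N) mu (cball d (x i) (r i)) <=
    (C * D)%:E * nu (cball d (x i0) (K * r i0) `&` S').
  apply: (@le_trans _ _ (C%:E * mu (cball d (x i0) (r i0)))).
    apply: (@le_trans _ _ (mu (cball d (x i0) (5 * K * r i0)))).
      apply: sum_disjoint_cball => // i; rewrite !inE => /andP[_ /andP[iP di]].
      apply: cball_sub => //; have ri := i0max _ iP.
      have /andP[ri0 _] := r01 i.
      have : (K * r i <= K * r i0)%R by rewrite ler_pM2l//; lra.
      have : (1 * r i <= K * r i)%R by rewrite ler_pM2r.
      by move: di; lra.
    apply: HC; rewrite ?r00// distxx// mulr_ge0//; lra.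
  by rewrite EFinM -muleA lee_wpmul2l ?lee_fin ?(ltW C0)//; exact: muD.
have H2 : \sum_(i in P :\: N) mu (cball d (x i) (r i)) <= (C * D)%:E * nu A'.
  apply: IH => [|i|i iPN y yi].
  - rewrite ltnS in cP; apply: leq_trans cP; apply: proper_card; apply/fintype.properP.
    split; first exact: finset.subsetDl.
    exists i0 => //; rewrite !inE negb_and negbK i0P distxx// mulr_ge0 ?addr_ge0//; lra.
  - by rewrite inE => /andP[_ iP]; exact: muD.
  - by exists i.
apply: le_trans (leeD H1 H2) _.
rewrite -ge0_muleDr ?cn.1// lee_wpmul2l ?lee_fin//.
have Kr0 : (0 < K * r i0)%R by rewrite mulr_gt0//; lra.
apply: le_trans (gn _ _ _ Kr0 _) _.
  move=> a b [ai _] [i /= iPN [bi _]].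
  move: iPN; rewrite !inE => /andP[+ iP]; rewrite iP/= -ltNge => far.
  have := dist_tri dmet (x i0) a (x i); have := dist_tri dmet a b (x i).
  rewrite (dist_sym dmet b (x i)).
  have Kri : (0 < K * r i)%R by rewrite mulr_gt0//; [lra|have /andP[] := r01 i].
  by move: ai bi far; rewrite /cball/=; lra.
apply: cn.2 => y [yi|[i /= iPN yi]]; first exact: sub yi.
by apply: sub yi; move: iPN; rewrite inE => /andP[].
Qed.

(* The layer-cake formula reduces the weighted sum to [vitali_sum] on each superlevel set. *)
Lemma carleson_sum (K : R) : (1 <= K)%R -> exists2 C : R, (0 < C)%R &
  forall (I : finType) (x : I -> T) (r : I -> R) (nu : set T -> \bar R) (S' : set T) (D : R)
    (P : {set I}) (a : I -> \bar R) (g : T -> \bar R),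
  disjoint_balls x r -> (forall i, 0 < r i <= 1)%R -> capacity nu -> gap_superadd d nu ->
  (0 <= D)%R ->
  (forall i, i \in P -> mu (cball d (x i) (r i)) <= D%:E * nu (cball d (x i) (K * r i) `&` S')) ->
  (forall i y, i \in P -> cball d (x i) (K * r i) y -> S' y -> a i <= g y) ->
  \sum_(i in P) mu (cball d (x i) (r i)) * a i <= (C * D)%:E * oint nu S' g.
Proof.
move=> K1; have [C C0 HC] := vitali_sum K1; exists C => //.
move=> I x r nu S' D P a g disj r01 cn gn D0 muD ag.
apply: (@le_trans _ _ (\sum_(i in P) oint mu (cball d (x i) (r i)) (fun=> a i))).
  by apply: lee_sum => i _; rewrite muleC; apply: oint_ge_cst.
apply: sum_oint_le => //; first by rewrite mulr_ge0// ltW.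
move=> t t0.
(* The remaining indices have an empty layer at level [t]; for those in [Pt] the trace of the
   dilated ball on [S'] lies in the superlevel set of [g]. *)
pose Pt := [set i in P | t%:E < a i]%SET.
apply: (@le_trans _ _ (\sum_(i in Pt) mu (cball d (x i) (r i)))).
  rewrite (big_setID Pt)/= [X in _ + X]big1 ?adde0; last first.
    move=> i; rewrite !inE => /andP[+ iP]; rewrite iP/= => ta.
    rewrite /layer (_ : [set _ | _] = set0) ?(outer_set0 outer_mu)//.
    by apply/seteqP; split=> // y [_]; rewrite (negbTE ta).
  rewrite (finset.setIidPr _); last by apply/fintype.subsetP => i; rewrite inE => /andP[].
  by apply: lee_sum => i _; apply: cap_mu.2 => y [].
apply: (HC _ _ _ nu S') => // [i|i]; rewrite inE => /andP[iP tai]; first exact: muD.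
move=> y [yi yS]; split=> //; apply: lt_le_trans tai _; exact: ag yi yS.
Qed.

(** The centres are twice as far apart as disjointness of the dilates requires; the excess is the
    positive distance that [gap_superadd] asks for. *)
Lemma independent_sum (K : R) (I : finType) (x : I -> T) (r : I -> R) (nu : set T -> \bar R)
    (J : {set I}) (A : set T) : (1 <= K)%R -> (forall i, 0 < r i <= 1)%R ->
  capacity nu -> gap_superadd d nu ->
  (forall i j, i \in J -> j \in J -> i != j -> (2 * K * (r i + r j) < d (x i) (x j))%R) ->
  \sum_(i in J) nu (cball d (x i) (K * r i) `&` A) <= nu A.
Proof.
move=> K1 r01 cn gn; have [n] := ubnP #|J|; elim: n J A => // n IH J A cJ far.
have [->|[i iJ]] := set_0Vmem J; first by rewrite big_set0 cn.1.
pose A' := A `&` \bigcup_(j in [set j | j \in J :\ i]) cball d (x j) (K * r j).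
rewrite (big_setD1 i iJ)/=.
have H : \sum_(j in J :\ i) nu (cball d (x j) (K * r j) `&` A) <= nu A'.
  apply: (@le_trans _ _ (\sum_(j in J :\ i) nu (cball d (x j) (K * r j) `&` A'))).
    by apply: lee_sum => j jJ; apply: cn.2 => y [yj yA]; split=> //; split=> //; exists j.
  apply: IH; first by move: cJ; rewrite (cardsD1 i J) iJ.
  by move=> j k; rewrite !inE => /andP[_ jJ] /andP[_ kJ]; exact: far.
apply: le_trans (leeD (le_refl _) H) _.
have /andP[ri0 _] := r01 i.
have Kri : (0 < K * r i)%R by rewrite mulr_gt0//; lra.
apply: le_trans (gn _ _ _ Kri _) _.
  move=> a b [ai _] [_ [j /= + bj]]; rewrite !inE => /andP[ji jJ].
  have := far _ _ iJ jJ; rewrite eq_sym => /(_ ji) fij.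
  have := dist_tri dmet (x i) a (x j); have := dist_tri dmet a b (x j).
  rewrite (dist_sym dmet b (x j)).
  have Krj : (0 < K * r j)%R by rewrite mulr_gt0//; [lra|have /andP[] := r01 j].
  by move: ai bj fij; rewrite /cball/=; lra.
by apply: cn.2 => y [[]|[]].
Qed.

(* Peel off maximal independent subfamilies: each one lowers the conflict degree by one. *)
Lemma bounded_overlap_sum (K : R) (I : finType) (x : I -> T) (r : I -> R)
    (nu : set T -> \bar R) (A : set T) (n : nat) (P : {set I}) :
  (1 <= K)%R -> (forall i, 0 < r i <= 1)%R -> capacity nu -> gap_superadd d nu ->
  (forall i, i \in P ->
     (#|[set j in P | (d (x i) (x j) <= 2 * K * (r i + r j))%R]| <= n)%N) ->
  \sum_(i in P) nu (cball d (x i) (K * r i) `&` A) <= n%:R%:E * nu A.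
Proof.
move=> K1 r01 cn gn; elim: n P => [|n IH] P deg.
  rewrite big1 ?mul0e// => i iP; exfalso; have := deg _ iP.
  rewrite leqn0 cards_eq0 => /eqP/setP/(_ i); rewrite !inE iP distxx//.
  have /andP[? _] := r01 i; rewrite mulr_ge0//; lra.
pose indep (J : {set I}) := (J \subset P) &&
  [forall i in J, forall j in J, (i != j) ==> (2 * K * (r i + r j) < d (x i) (x j))%R].
have indep0 : indep finset.set0.
  rewrite /indep finset.sub0set/=; apply/forall_inP => i; by rewrite inE.
have [J /maxsetP[/andP[JP /forall_inP Jfar] Jmax] _] := @maxset_exists _ indep _ indep0.
have {}Jfar i j : i \in J -> j \in J -> i != j -> (2 * K * (r i + r j) < d (x i) (x j))%R.
  by move=> iJ jJ ij; have /forall_inP/(_ _ jJ)/implyP := Jfar _ iJ; apply.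
rewrite (big_setID J)/= (finset.setIidPr JP) -natr1 EFinD ge0_muleDl ?lee_fin// addeC mul1e.
apply: leeD; last exact: independent_sum.
apply: IH => i; rewrite inE => /andP[iJ iP].
have [j jJ ij] : exists2 j, j \in J & (d (x i) (x j) <= 2 * K * (r i + r j))%R.
  apply: contrapT => noj; move/negP: iJ; apply.
  have -> // : J = (i |: J)%SET; last by rewrite !inE eqxx.
  apply/esym; apply: Jmax; last exact: finset.subsetUr.
  have far j : j \in J -> (2 * K * (r i + r j) < d (x i) (x j))%R.
    by move=> jJ; rewrite ltNge; apply/negP => H; apply: noj; exists j.
  rewrite /indep finset.subUset finset.sub1set iP JP/=.
  apply/forall_inP => a; rewrite !inE => /orP[/eqP ->|aJ];
    apply/forall_inP => b; rewrite !inE => /orP[/eqP ->|bJ]; apply/implyP => //.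
  - by rewrite eqxx.
  - by move=> _; exact: far.
  - by move=> _; rewrite (dist_sym dmet) [(r a + _)%R]addrC; exact: far.
  - exact: Jfar.
have := deg _ iP; rewrite (cardsD1 j) !inE (fintype.subsetP JP _ jJ) ij/= add1n ltnS.
apply: leq_trans; apply: subset_leq_card; apply/fintype.subsetP => k; rewrite !inE.
move=> /andP[/andP[kJ kP] ik]; rewrite kP ik andbT andbT.
by apply: contraNneq kJ => ->.
Qed.

(** Radii between [r0] and [1] bound the conflict degree: the balls in conflict with a given one are
    disjoint, lie in one ball of radius [4 * K + 1], and each carries at least the fraction [1 / C]
    of its mass. *)
Lemma large_overlap (K r0 : R) : (1 <= K)%R -> (0 < r0)%R -> exists n : nat,
  forall (I : finType) (x : I -> T) (r : I -> R) (nu : set T -> \bar R) (S' : set T)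
    (P : {set I}) (g : T -> \bar R),
  disjoint_balls x r -> (forall i, 0 < r i <= 1)%R -> capacity nu -> gap_superadd d nu ->
  (forall i, i \in P -> (r0 <= r i)%R) ->
  \sum_(i in P) oint nu (cball d (x i) (K * r i) `&` S') g <= n%:R%:E * oint nu S' g.
Proof.
move=> K1 r00; have L0 : (0 < (4 * K + 1) / r0)%R by rewrite divr_gt0//; lra.
have [C C0 HC] := doubling_gen dmet outer_mu doubling_mu L0 ltr01.
exists (Num.truncn C) => I x r nu S' P g disj r01 cn gn r0P.
apply: sum_oint_le => // t t0.
apply: (@le_trans _ _ (\sum_(i in P) nu (cball d (x i) (K * r i) `&` [set y | S' y /\ t%:E < g y]))).
  by apply: lee_sum => i _; apply: cn.2 => y [[? ?] ?].
apply: bounded_overlap_sum => // i iP.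
set N := [set j in P | _]%SET.
have K40 : (0 < 4 * K + 1)%R by lra.
have [b b0 mb] := ball_posfin dmet outer_mu locfin_mu supp_mu doubling_mu (x i) K40.
have near j : j \in N -> (d (x i) (x j) <= 4 * K)%R.
  rewrite inE => /andP[jP /le_trans]; apply.
  have /andP[_ ?] := r01 i; have /andP[_ ?] := r01 j.
  have : (K * (r i + r j) <= K * 2)%R by rewrite ler_pM2l//; lra.
  by lra.
have : \sum_(j in N) mu (cball d (x j) (r j)) <= mu (cball d (x i) (4 * K + 1)).
  apply: sum_disjoint_cball => // j jN; apply: cball_sub => //.
  by have := near _ jN; have /andP[_ ?] := r01 j; lra.
have low j : j \in N -> (b / C)%:E <= mu (cball d (x j) (r j)).
  move=> jN; have jP : j \in P by move: jN; rewrite inE => /andP[].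
  have rr : (4 * K + 1 <= (4 * K + 1) / r0 * r j)%R.
    by rewrite mulrAC ler_pdivlMr// ler_pM2l// r0P.
  rewrite mulrC EFinM lee_pdivrMl// -mb; apply: HC; rewrite ?r01//.
  by rewrite (dist_sym dmet); have := near _ jN; lra.
move=> /(le_trans (lee_sum _ low)); rewrite sumEFin mb lee_fin sumr_const => H.
have {}H : (#|N|%:R * (b / C) <= b)%R by rewrite mulr_natl.
rewrite truncn_ge_nat ?(ltW C0)//.
by move: H; rewrite mulrA ler_pdivrMr// [(b * C)%R]mulrC ler_pM2r.
Qed.

End Covering.

(** * Local estimates *)

Section DyadicScale.
Variable R : realType.
Implicit Types (r : R) (k : nat).

(** The default of [xget] is not an issue: the least [k] with [2 ^- k.+1 < r] satisfies the other
    inequality by minimality, or by [r <= 1] when it is [0]. *)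
Lemma kr_spec r : 0 < r <= 1 -> 2 ^- (kr r).+1 < r <= 2 ^- (kr r).
Proof.
move=> /andP[r0 r1].
have ex : exists k, 2 ^- k.+1 < r.
  have [n Hn] := two_pow_gt r^-1; exists n.
  rewrite invf_plt ?posrE ?exprn_gt0//; apply: le_lt_trans Hn _.
  by rewrite ltr_eXn2l// ltr1n.
have [k0 k0r k0min] := ex_minnP ex.
rewrite /kr; case: xgetP => [k -> //|/(_ k0)[]] /=; rewrite k0r/=.
case: k0 {k0r} k0min => [|k0] k0min; first by rewrite expr0 invr1.
by rewrite leNgt; apply/negP => /k0min; rewrite ltnn.
Qed.

Lemma dyadic_powR k (th : R) : (2 ^+ k) `^ th = 2 `^ (k%:R * th) :> R.
Proof. by rewrite -powR_mulrn// powRrM. Qed.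

Lemma invr_powR r (th : R) : 0 < r -> r^-1 `^ th = r `^ (- th).
Proof. by move=> r0; rewrite -powR_inv1 ?(ltW r0)// -powRrM mulN1r. Qed.

Lemma dyadic_powR_le r k (th : R) : 0 <= th -> 0 < r -> r <= 2 ^- k ->
  2 `^ (k%:R * th) <= r `^ (- th).
Proof.
move=> th0 r0 rk; rewrite -invr_powR// -dyadic_powR.
apply: ge0_ler_powR; rewrite ?nnegrE ?exprn_ge0 ?invr_ge0 ?(ltW r0)//.
by rewrite -[leLHS]invrK lef_pV2// posrE invr_gt0 exprn_gt0.
Qed.

Lemma dyadic_powR_ge r k (th : R) : 0 <= th -> 2 ^- k.+1 < r ->
  r `^ (- th) <= 2 `^ th * 2 `^ (k%:R * th).
Proof.
move=> th0 rk.
have r0 : 0 < r by apply: lt_trans rk; rewrite invr_gt0 exprn_gt0.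
rewrite -invr_powR// -powRD; last by apply/implyP.
have -> : th + k%:R * th = k.+1%:R * th by rewrite -natr1 mulrDl mul1r addrC.
rewrite -dyadic_powR; apply: ge0_ler_powR; rewrite ?nnegrE ?exprn_ge0 ?invr_ge0 ?(ltW r0)//.
by rewrite -[leRHS]invrK lef_pV2 ?posrE// ?invr_gt0 ?exprn_gt0// ltW.
Qed.

End DyadicScale.

(** The larger of [u] and [v] bounds the bracket up to a factor 9, rounded up to 10. An alternative,
    unlike a sum, lets each ball be charged to one functional. *)
Lemma add_dichotomy (R : realType) (X u v : \bar R) (K : R) : (0 <= K)%R ->
  (0 <= u)%E -> (0 <= v)%E -> (X <= K%:E * ((4%:E * u + 4%:E * v) + v))%E ->
  (X <= (10 * K)%:E * u)%E \/ (X <= (10 * K)%:E * v)%E.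
Proof.
move=> K0 u0 v0 Xuv.
have comb (u' w z : \bar R) : (0 <= u' -> u' <= z -> 0 <= w -> w <= z ->
    (4%:E * u' + 4%:E * w) + w <= 10%:E * z)%E.
  case: z => [z| |].
  - case: u' => [u'||]//; case: w => [w||]// u'0 uz w0 wz.
    by move: u'0 uz w0 wz; rewrite -!EFinM -!EFinD !lee_fin; lra.
  - by move=> *; rewrite gt0_muley ?lte_fin// leey.
  - by move=> u'0 /(le_trans u'0).
have E10 : (10 * K)%:E = (K%:E * 10%:E)%E by rewrite -EFinM mulrC.
rewrite E10 -!muleA; have [uv|vu] := leP u v; [right|left].
  by apply: (le_trans Xuv); apply: lee_wpmul2l; rewrite ?lee_fin//; exact: comb.
by apply: (le_trans Xuv); apply: lee_wpmul2l; rewrite ?lee_fin//; apply: comb => //; exact: ltW.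
Qed.

Section Local.
Variables (R : realType) (T : Type) (d : T -> T -> R).
Hypothesis dmet : is_metric d.
Variable mu : set T -> \bar R.
Hypothesis outer_mu : is_outer_measure mu.
Hypothesis borel_mu : borel_regular d mu.
Hypothesis locfin_mu : locally_finite d mu.
Hypothesis supp_mu : supp d mu = setT.
Hypothesis doubling_mu : unif_loc_doubling d mu.
Variables (th2 th : R) (S1 S2 : set T).
Hypothesis th20 : 0 < th2.
Hypothesis ADR1 : ADR d mu 0 S1.
Hypothesis ADR2 : ADR d mu th2 S2.
Variables (c : R) (s : nat).
Hypothesis c1 : 1 <= c.
Hypothesis s_c : 8 * c <= 2 ^+ s.
Local Open Scope ereal_scope.

Let cap_mu := outer_capacity outer_mu.
Let cap_H0 := Haus_capacity d cap_mu 0.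
Let cap_H2 := Haus_capacity d cap_mu th2.

Local Notation H0 := (Haus d mu 0).
Local Notation H2 := (Haus d mu th2).
Local Notation q k := (2 `^ (k%:R * th2))%R.

Definition at_scale (r : R) (k : nat) := (0 < r <= 1)%R /\ (2 ^- k.+1 < r <= 2 ^- k)%R.

(* At scale [k], [q k] stands for [r `^ (- th2)]. *)
Record comparable_at (C : R) (x : T) (r V : R) (k : nat) (y : T) : Prop := ComparableAt {
  cmp_mu : forall t, (t <= 2 ^+ s.+1 * r)%R -> mu (cball d y t) <= (C * V)%:E;
  cmp_S1_lo : S1 y -> V%:E <= C%:E * mu (cball d y r `&` S1);
  cmp_S1_up : forall t, S1 y -> (0 < t <= 1)%R -> (t <= 2 ^+ s.+1 * r)%R ->
    H0 (cball d y t `&` S1) <= (C * V)%:E;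
  cmp_S2_lo : S2 y -> (q k * V)%:E <= C%:E * H2 (cball d y r `&` S2);
  cmp_S2_up : forall t, S2 y -> (r <= t <= 1)%R -> (t <= 2 ^+ s.+1 * r)%R ->
    H2 (cball d y t `&` S2) <= (C * (q k * V))%:E }.

(** On [S1] the lower bound is kept for the smaller [mu] and the upper one for the larger [H0], so
    either measure can be compared with [V]. On [S2] the upper bound takes [t] at least [r], so that
    the negative power of [t] in the regularity condition is at most [P2 * q k]. *)
Lemma comparable_near : exists2 C : R, (1 <= C)%R & forall x (r : R) k V, at_scale r k ->
  mu (cball d x r) = V%:E -> (0 < V)%R ->
  forall y, (d x y <= 4 * c * r)%R -> comparable_at C x r V k y.
Proof.
have L0 : (0 < 2 ^+ s.+1 :> R)%R by rewrite exprn_gt0.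
have [C1 C10 HC1] := doubling_gen dmet outer_mu doubling_mu L0 ltr01.
have [C2 C20 HC2] := ADR0_lower dmet outer_mu borel_mu locfin_mu supp_mu doubling_mu ADR1.
have [_ [k1 [k2 [k10 [k20 HA1]]]]] := ADR1.
have [_ [l1 [l2 [l10 [l20 HA2]]]]] := ADR2.
pose P2 := (2 `^ th2 : R)%R.
have P20 : (0 < P2)%R by rewrite powR_gt0.
pose C := (1 + C1 + C2 * C1 + k2 * C1 + C1 / l1 + l2 * P2 * C1)%R.
have [e1 e2 e3 e4] : [/\ 0 < C2 * C1, 0 < k2 * C1, 0 < C1 / l1 & 0 < l2 * P2 * C1]%R.
  by rewrite !mulr_gt0// invr_gt0.
exists C; first by rewrite /C; lra.
move=> x r k V [/andP[r0 r1] /andP[rk1 rk]] mV V0 y xy.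
have rle : (0 < r <= 1)%R by rewrite r0.
have cr : (4 * c * r <= 2 ^+ s.+1 * r)%R.
  have : (0 < 2 ^+ s :> R)%R by rewrite exprn_gt0.
  rewrite ler_pM2r// exprS; move: s_c; move: (2 ^+ s)%R => P sP P0.
  by lra.
have d1 : (d x y <= 2 ^+ s.+1 * r)%R by exact: le_trans xy cr.
have d2 : (d y x <= 2 ^+ s.+1 * r)%R by rewrite dist_sym.
have rL : (r <= 2 ^+ s.+1 * r)%R by rewrite ler_peMl ?(ltW r0)// exprn_ege1// ler1n.
have up t : (t <= 2 ^+ s.+1 * r)%R -> mu (cball d y t) <= (C1 * V)%:E.
  by move=> tr; rewrite EFinM -mV; apply: HC1.
have lo : V%:E <= C1%:E * mu (cball d y r) by rewrite -mV; apply: HC1.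
have CV (e : R) : (e <= C)%R -> (e * V <= C * V)%R by move=> ?; rewrite ler_pM2r.
have q0 : (0 < q k)%R by rewrite powR_gt0.
split.
- by move=> t tr; apply: le_trans (up t tr) _; rewrite lee_fin CV// /C; lra.
- move=> yS; apply: (le_trans lo).
  apply: (@le_trans _ _ ((C2 * C1)%:E * mu (cball d y r `&` S1))).
    rewrite mulrC EFinM -muleA lee_wpmul2l ?lee_fin ?(ltW C10)//; exact: HC2.
  by rewrite lee_wpmul2r ?cap_mu.1// lee_fin /C; lra.
- move=> t yS t01 tr; have [_] := HA1 y t yS t01.
  rewrite oppr0 powRr0 mulr1 => /le_trans; apply.
  apply: (@le_trans _ _ ((k2 * C1) * V)%:E).
    by rewrite -mulrA EFinM lee_wpmul2l ?lee_fin ?(ltW k20)//; exact: up.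
  by rewrite lee_fin CV// /C; lra.
- move=> yS; have [lo2 _] := HA2 y r yS rle.
  apply: (@le_trans _ _ ((C1 / l1)%:E * H2 (cball d y r `&` S2))); last first.
    by rewrite lee_wpmul2r ?cap_H2.1// lee_fin /C; lra.
  rewrite [(C1 / l1)%:E]EFinM -muleA.
  apply: (@le_trans _ _ (C1%:E * ((r `^ (- th2))%:E * mu (cball d y r)))).
    rewrite muleCA EFinM; apply: lee_pmul => //; rewrite ?lee_fin ?(ltW q0) ?(ltW V0)//.
    by apply: dyadic_powR_le => //; exact: ltW.
  by rewrite lee_wpmul2l ?lee_fin ?(ltW C10)// lee_pdivlMl// muleA -EFinM.
- move=> t yS /andP[rt t1] tr.
  have t01 : (0 < t <= 1)%R by rewrite t1 andbT; exact: lt_le_trans rt.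
  have [_] := HA2 y t yS t01 => /le_trans; apply.
  apply: (@le_trans _ _ ((l2 * (P2 * q k)) * (C1 * V))%:E).
    rewrite [leRHS]EFinM; apply: lee_pmul; rewrite ?cap_mu.1//; last exact: up.
      by rewrite lee_fin mulr_ge0 ?powR_ge0// ltW.
    rewrite lee_fin ler_pM2l//.
    apply: dyadic_powR_ge; [exact: ltW|exact: lt_le_trans rk1 rt].
  have -> : (l2 * (P2 * q k) * (C1 * V) = (l2 * P2 * C1) * (q k * V))%R by ring.
  by rewrite lee_fin ler_pM2r ?mulr_gt0// /C; lra.
Qed.

Local Notation mk k := (mk_seq d mu th th2 S1 S2 k).

Lemma mk_seqE k A : mk k A = (2 `^ (k%:R * th))%:E * mu (A `&` S1) +
  (2 `^ (k%:R * (th - th2)))%:E * H2 (A `&` S2).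
Proof. by []. Qed.

Lemma mk_capacity k : capacity (mk k).
Proof.
split=> [A|A B AB]; rewrite /mk_seq.
  by rewrite adde_ge0// mule_ge0 ?lee_fin ?powR_ge0 ?cap_mu.1 ?cap_H2.1.
by apply: leeD; rewrite lee_wpmul2l ?lee_fin ?powR_ge0//; [apply: cap_mu.2|apply: cap_H2.2];
  exact: setSI.
Qed.

Lemma mk_subadd2 k : subadd2 (mk k).
Proof.
move=> A B; rewrite !mk_seqE !setIUl addeACA.
rewrite -!ge0_muleDr ?cap_mu.1 ?cap_H2.1//.
apply: leeD; rewrite lee_wpmul2l ?lee_fin ?powR_ge0//; first exact: outer_subadd2.
exact: Haus_subadd2.
Qed.

Lemma mk_set0 k : inhabited T -> mk k set0 = 0.
Proof.
by move=> inT; rewrite mk_seqE !set0I Haus_set0// (outer_set0 outer_mu) !mule0 adde0.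
Qed.

Lemma restr_capacity (m : set T -> \bar R) (S' : set T) : capacity m -> capacity (restr m S').
Proof.
by move=> cm; split=> [A|A B AB]; [exact: cm.1|apply: cm.2; exact: setSI].
Qed.

Lemma fsharp_ge0 f y : 0 <= fsharp d mu S1 f y.
Proof.
apply: le_trans (ereal_sup_ubound _); last by exists 1%R => //=; rewrite ltr01 ler1n.
rewrite mule_ge0 ?lee_fin ?invr_ge0// Ecal_ge0//; exact: restr_capacity.
Qed.

(** The weights in [mk k] are balanced: whichever piece meets the ball carries mass of order 2^(k
    th) V, since on [S2] the factors 2^(k (th - th2)) and [q k] multiply to 2^(k th). *)
Lemma mk_lower (C V r : R) k x : (0 < C)%R -> (0 < r)%R ->
  (forall y, (d x y <= 4 * c * r)%R -> comparable_at C x r V k y) ->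
  (exists y, (S1 `|` S2) y /\ (d x y <= c * r)%R) ->
  (2 `^ (k%:R * th) * V)%:E <= C%:E * mk k (cball d x (2 * (c * r))).
Proof.
move=> C0 r0 HC [w [wS xw]]; have c1' := c1.
have rcr : (r <= c * r)%R by rewrite ler_peMl// ltW.
have xw4 : (d x w <= 4 * c * r)%R by lra.
have sub : cball d w r `<=` cball d x (2 * (c * r)) by apply: cball_sub => //; lra.
rewrite mk_seqE; set a := (2 `^ (k%:R * th) : R)%R; set b := (2 `^ (k%:R * (th - th2)) : R)%R.
have a0 : (0 < a)%R by rewrite powR_gt0.
have b0 : (0 < b)%R by rewrite powR_gt0.
have abq : (a = b * q k)%R.
  rewrite /a /b -powRD; last by apply/implyP.
  by rewrite -mulrDr subrK.
case: wS => wS.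
- apply: (@le_trans _ _ (C%:E * (a%:E * mu (cball d x (2 * (c * r)) `&` S1)))); last first.
    rewrite lee_wpmul2l ?lee_fin ?(ltW C0)// leeDl// mule_ge0 ?cap_H2.1//.
    by rewrite lee_fin ltW.
  rewrite EFinM muleCA lee_wpmul2l ?lee_fin ?(ltW a0)//.
  apply: le_trans (cmp_S1_lo (HC _ xw4) wS) _.
  by rewrite lee_wpmul2l ?lee_fin ?(ltW C0)//; apply: cap_mu.2; exact: setSI.
- apply: (@le_trans _ _ (C%:E * (b%:E * H2 (cball d x (2 * (c * r)) `&` S2)))); last first.
    rewrite lee_wpmul2l ?lee_fin ?(ltW C0)// leeDr// mule_ge0 ?cap_mu.1//.
    by rewrite lee_fin ltW.
  rewrite abq -mulrA EFinM muleCA lee_wpmul2l ?lee_fin ?(ltW b0)//.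
  apply: le_trans (cmp_S2_lo (HC _ xw4) wS) _.
  by rewrite lee_wpmul2l ?lee_fin ?(ltW C0)//; apply: cap_H2.2; exact: setSI.
Qed.

(** The two clauses are shaped for [carleson_sum]: enough mass of [S1] in the dilated ball, and a
    bound valid at each of its points in [S1]. *)
Definition fsharp_dominated (C : R) f x (r : R) (X : \bar R) :=
  mu (cball d x r) <= C%:E * mu (cball d x (4 * c * r) `&` S1) /\
  forall y, S1 y -> (d x y <= 4 * c * r)%R -> X <= (C * r)%:E * fsharp d mu S1 f y.

(* By [s_c], the radius [2 ^- (k - s)] exceeds [8 * c * r] when [r <= 2 ^- k]. *)
Definition besov_dominated (C : R) f x (r : R) k (X : \bar R) :=
  mu (cball d x r) <= (C / q k)%:E * H2 (cball d x (4 * c * r) `&` S2) /\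
  forall y, S2 y -> (d x y <= 4 * c * r)%R ->
    X <= C%:E * Ecal (restr H2 S2) f (cball d y (2 ^- (k - s))).

(** The masses on [S1] and [S2] serve the outer and the inner integral of the gluing term; the third
    clause bounds the weight [wk] from below. *)
Definition gluing_dominated (C : R) f x (r : R) k (X : \bar R) :=
  [/\ mu (cball d x r) <= C%:E * mu (cball d x (4 * c * r) `&` S1),
    mu (cball d x r) <= (C / q k)%:E * H2 (cball d x (4 * c * r) `&` S2),
    (forall y, (d x y <= 4 * c * r)%R ->
      mu (cball d y (2 ^- (k - s))) <= C%:E * mu (cball d x r)) &
    forall y z, S2 y -> (d x y <= 4 * c * r)%R -> S1 z -> (d x z <= 4 * c * r)%R ->
      X <= C%:E * Ak d mu S2 S1 th2 0 (k - s) f y z].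

(** The condition [s < k] keeps [8 * c * r <= 2 ^- (k - s) <= 1], within the radii allowed by
    regularity and by [fsharp], and makes [k - s] an index of the Besov and gluing series. *)
Lemma local_estimate : inhabited T -> exists2 C : R, (0 < C)%R &
  forall f x (r : R) k, at_scale r k -> (s < k)%N ->
  (exists y, (S1 `|` S2) y /\ (d x y <= c * r)%R) ->
  let X := Ecal (mk k) f (cball d x (2 * (c * r))) in
  [\/ fsharp_dominated C f x r X, besov_dominated C f x r k X
    | gluing_dominated C f x r k X].
Proof.
move=> inT; have [C C1 HC] := comparable_near; have c1' := c1.
have C0 : (0 < C)%R by lra.
have Cexp n : (1 <= C ^+ n)%R by exact: exprn_ege1.
have C2C6 : (C ^+ 2 <= C ^+ 6)%R by rewrite ler_weXn2l.
have C4C6 : (C ^+ 4 <= C ^+ 6)%R by rewrite ler_weXn2l.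
have C1C6 : (C <= C ^+ 6)%R by rewrite -[leLHS]expr1 ler_weXn2l.
(* The 10 comes from [add_dichotomy], the three factors [C ^+ 2] from splitting into two pieces and
   enlarging two balls, and [c] from testing [fsharp] at radius [8 * c * r]. *)
pose Ct := (10 * c * C ^+ 6)%R.
have cC6 (u : R) : (u <= 10 * C ^+ 6)%R -> (u <= Ct)%R.
  move=> /le_trans; apply; rewrite /Ct -mulrA ler_pM2l//.
  by rewrite ler_peMl// exprn_ge0// ltW.
have CCt : (C <= Ct)%R by apply: cC6; have := Cexp 6%N; lra.
have Ct0 : (0 < Ct)%R by lra.
exists Ct => // f x r k rk sk nearS X.
have [/andP[r0 r1] /andP[rk1 rk2]] := rk.
have p2s : (0 < 2 ^+ s :> R)%R by rewrite exprn_gt0.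
pose sg : R := (2 ^- (k - s))%R.
have sgE : (sg = 2 ^+ s * 2 ^- k)%R.
  have E : (2 ^+ k = 2 ^+ (k - s) * 2 ^+ s :> R)%R by rewrite -exprD subnK// ltnW.
  by rewrite /sg E invfM mulrCA mulfV ?mulr1// gt_eqF.
have sg_lo : (8 * c * r <= sg)%R.
  by rewrite sgE; apply: ler_pM => //; lra.
have sg_up : (sg <= 2 ^+ s.+1 * r)%R.
  rewrite sgE exprSr -mulrA ler_pM2l//; apply: ltW.
  have -> : (2 ^- k = 2 * 2 ^- k.+1 :> R)%R.
    by rewrite exprS invfM mulrA mulfV ?mul1r.
  by rewrite ltr_pM2l.
have sg1 : (sg <= 1)%R by rewrite /sg invf_le1 ?exprn_gt0// exprn_ege1// ler1n.
have rcr : (r <= c * r)%R by rewrite ler_peMl// ltW.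
have sg0 : (0 < sg)%R by rewrite invr_gt0 exprn_gt0.
have [V V0 mV] := ball_posfin dmet outer_mu locfin_mu supp_mu doubling_mu x r0.
have {}HC y : (d x y <= 4 * c * r)%R -> comparable_at C x r V k y by exact: HC.
have q0 : (0 < q k)%R by rewrite powR_gt0.
pose a := (2 `^ (k%:R * th) : R)%R; pose b := (2 `^ (k%:R * (th - th2)) : R)%R.
have a0 : (0 < a)%R by rewrite powR_gt0.
have b0 : (0 < b)%R by rewrite powR_gt0.
have abq : (a = b * q k)%R.
  rewrite /a /b -powRD; last by apply/implyP.
  by rewrite -mulrDr subrK.
have mE A : mk k A = a%:E * mu (A `&` S1) + b%:E * H2 (A `&` S2) by [].
have mS1 A : a%:E * mu (A `&` S1) <= mk k A.
  by rewrite mE leeDl// mule_ge0 ?lee_fin ?(ltW b0) ?cap_H2.1.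
have mS2 A : b%:E * H2 (A `&` S2) <= mk k A.
  by rewrite mE leeDr// mule_ge0 ?lee_fin ?(ltW a0) ?cap_mu.1.
have cm := mk_capacity k.
have cr1 := restr_capacity S1 cap_mu.
have cr2 := restr_capacity S2 cap_H2.
have sub_small y : (d x y <= c * r)%R -> cball d y r `<=` cball d x (2 * (c * r)).
  by move=> xy; apply: cball_sub => //; lra.
have sub_big y : (d x y <= 2 * (c * r))%R -> cball d y r `<=` cball d x (4 * c * r).
  by move=> xy; apply: cball_sub => //; lra.
have lo1 y : S1 y -> (d x y <= 2 * (c * r))%R ->
    mu (cball d x r) <= C%:E * mu (cball d x (4 * c * r) `&` S1).
  move=> yS xy; have xy4 : (d x y <= 4 * c * r)%R by lra.
  rewrite mV; apply: le_trans (cmp_S1_lo (HC _ xy4) yS) _.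
  rewrite lee_wpmul2l ?lee_fin ?(ltW C0)//; apply: cap_mu.2; apply: setSI.
  exact: sub_big.
have lo2 y : S2 y -> (d x y <= 2 * (c * r))%R ->
    mu (cball d x r) <= (C / q k)%:E * H2 (cball d x (4 * c * r) `&` S2).
  move=> yS xy; have xy4 : (d x y <= 4 * c * r)%R by lra.
  rewrite mV mulrC EFinM -muleA lee_pdivlMl// -EFinM.
  apply: le_trans (cmp_S2_lo (HC _ xy4) yS) _.
  rewrite lee_wpmul2l ?lee_fin ?(ltW C0)//; apply: cap_H2.2; apply: setSI.
  exact: sub_big.
have CtM (A : set T) m : capacity m -> C%:E * m A <= Ct%:E * m A.
  by move=> cm'; rewrite lee_wpmul2r ?cm'.1// lee_fin.
have CtqM (A : set T) : (C / q k)%:E * H2 A <= (Ct / q k)%:E * H2 A.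
  by rewrite lee_wpmul2r ?cap_H2.1// lee_fin ler_pM2r ?invr_gt0.
have chain (u v : \bar R) (W : R) : u <= (C * W)%:E -> W%:E <= C%:E * v -> u <= (C ^+ 2)%:E * v.
  move=> uW Wv; apply: (le_trans uW); rewrite expr2 !EFinM -muleA.
  by rewrite lee_wpmul2l ?lee_fin ?(ltW C0).
have divC (v u M : \bar R) (t : R) : (0 < t)%R -> u <= (C ^+ 2)%:E * v ->
    t%:E * v <= M -> u <= (C ^+ 2 / t)%:E * M.
  move=> t0 uv vM; apply: (le_trans uv).
  rewrite [(C ^+ 2 / t)%:E]EFinM -muleA lee_wpmul2l ?lee_fin ?exprn_ge0 ?(ltW C0)//.
  by rewrite lee_pdivlMl.
have [noS2|] := pselect (cball d x (2 * (c * r)) `&` S2 = set0).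
  have [y1 [yS xy1]] := nearS.
  have {}yS : S1 y1.
    case: yS => // yS; exfalso; suff : set0 y1 by [].
    by rewrite -noS2; split=> //; rewrite /cball/=; lra.
  have xy12 : (d x y1 <= 2 * (c * r))%R by lra.
  apply: Or31; split; first exact: le_trans (lo1 _ yS xy12) (CtM _ _ cap_mu).
  move=> y yS1 xy.
  have c8r0 : (0 < 8 * c * r)%R by rewrite mulr_gt0//; lra.
  apply: (@le_trans _ _ ((C ^+ 2 * (8 * c * r))%:E * fsharp d mu S1 f y)); last first.
    rewrite lee_wpmul2r ?fsharp_ge0// lee_fin /Ct.
    have cr0 : (0 < c * r)%R by lra.
    have : (c * r * C ^+ 2 <= c * r * C ^+ 6)%R by rewrite ler_pM2l.
    have : (0 <= c * r * C ^+ 6)%R by rewrite mulr_ge0 ?exprn_ge0 ?ltW.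
    by lra.
  apply: (@le_trans _ _ ((C ^+ 2)%:E * Ecal (restr mu S1) f (cball d y (8 * c * r)))).
    (* On this ball [mk k] is [a] times [mu] on [S1]; the weight enters both the integral and the
       normalization, and cancels. *)
    have -> : (C ^+ 2 = a * (C ^+ 2 / a))%R by rewrite mulrCA mulfV ?mulr1// gt_eqF.
    apply: (le_Ecal_scale _ cm cr1) => //.
    - by rewrite divr_gt0// exprn_gt0.
    - by apply: cball_sub => //; rewrite (dist_sym dmet); lra.
    - move=> A AE; rewrite mE (_ : A `&` S2 = set0) ?Haus_set0// ?mule0 ?adde0//.
      by rewrite -subset0 -noS2; exact: setSI.
    apply: (@divC (mu (cball d x (2 * (c * r)) `&` S1))) => //.
    apply: (@chain _ _ V).
      apply: le_trans (cap_mu.2 _ _ (@subIsetl _ _ _)) _.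
      by apply: (cmp_mu (HC _ xy)); exact: le_trans sg_lo sg_up.
    have xy14 : (d x y1 <= 4 * c * r)%R by lra.
    apply: le_trans (cmp_S1_lo (HC _ xy14) yS) _.
    rewrite lee_wpmul2l ?lee_fin ?(ltW C0)//; apply: cap_mu.2; apply: setSI.
    exact: sub_small.
  rewrite [(C ^+ 2 * (8 * c * r))%:E]EFinM -muleA lee_wpmul2l ?lee_fin ?exprn_ge0 ?(ltW C0)//.
  rewrite -lee_pdivrMl//; apply: ereal_sup_ubound; exists (8 * c * r)%R => //=.
  by rewrite c8r0/=; lra.
move=> /eqP/set0P[y2 [xy2 yS2]].
have {}xy2 : (d x y2 <= 2 * (c * r))%R by [].
have xy24 : (d x y2 <= 4 * c * r)%R by lra.
have [noS1|] := pselect (cball d x (2 * (c * r)) `&` S1 = set0).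
  have [w [wS xw]] := nearS.
  have {}wS : S2 w.
    case: wS => // wS; exfalso; suff : set0 w by [].
    by rewrite -noS1; split=> //; rewrite /cball/=; lra.
  have xw4 : (d x w <= 4 * c * r)%R by lra.
  apply: Or32; split; first exact: le_trans (lo2 _ yS2 xy2) (CtqM _).
  move=> y yS xy.
  apply: (@le_trans _ _ ((C ^+ 2)%:E * Ecal (restr H2 S2) f (cball d y sg))); last first.
    rewrite lee_wpmul2r ?(Ecal_ge0 _ _ cr2) ?lee_fin//.
    by apply: cC6; apply: le_trans C2C6 _; rewrite ler_peMl ?ler1n// exprn_ge0// ltW.
  have -> : (C ^+ 2 = b * (C ^+ 2 / b))%R by rewrite mulrCA mulfV ?mulr1// gt_eqF.
  apply: (le_Ecal_scale _ cm cr2) => //.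
  - by rewrite divr_gt0// exprn_gt0.
  - by apply: cball_sub => //; rewrite (dist_sym dmet); lra.
  - move=> A AE; rewrite mE (_ : A `&` S1 = set0) ?(outer_set0 outer_mu)// ?mule0 ?add0e//.
    by rewrite -subset0 -noS1; exact: setSI.
  apply: (@divC (H2 (cball d x (2 * (c * r)) `&` S2))) => //.
  apply: (@chain _ _ (q k * V)%R).
    by apply: (cmp_S2_up (HC _ xy)) => //; rewrite sg1 andbT; lra.
  apply: le_trans (cmp_S2_lo (HC _ xw4) wS) _.
  rewrite lee_wpmul2l ?lee_fin ?(ltW C0)//; apply: cap_H2.2; apply: setSI.
  exact: sub_small.
move=> /eqP/set0P[y1 [xy1 yS1]].
have {}xy1 : (d x y1 <= 2 * (c * r))%R by [].
have xy14 : (d x y1 <= 4 * c * r)%R by lra.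
set E := cball d x (2 * (c * r)) in mS1 mS2 sub_small X *.
(* From here on the means over [S1] are taken for [H0], as in [Ak]: [mu_le_Haus0] bounds the
   integrals, and regularity keeps the total mass of order [V]. *)
set G1 := cball d x (4 * c * r) `&` S1.
set G2 := cball d x (4 * c * r) `&` S2.
have EB : E `<=` cball d x (4 * c * r) by apply: cball_sub => //; rewrite distxx//; lra.
have aV : (a * V)%:E <= C%:E * mk k E by apply: mk_lower.
have G1_up : H0 G1 <= (C * V)%:E.
  apply: (@le_trans _ _ (H0 (cball d y1 (8 * c * r) `&` S1))).
    apply: cap_H0.2; apply: setSI; apply: cball_sub => //.
    by rewrite (dist_sym dmet); lra.
  apply: (cmp_S1_up (HC _ xy14)) => //; last exact: le_trans sg_lo sg_up.
  by apply/andP; split; [rewrite mulr_gt0//; lra|lra].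
have G2_up : H2 G2 <= (C * (q k * V))%:E.
  apply: (@le_trans _ _ (H2 (cball d y2 (8 * c * r) `&` S2))).
    apply: cap_H2.2; apply: setSI; apply: cball_sub => //.
    by rewrite (dist_sym dmet); lra.
  apply: (cmp_S2_up (HC _ xy24)) => //; last exact: le_trans sg_lo sg_up.
  by apply/andP; split; lra.
have G1_lo : V%:E <= C%:E * H0 G1.
  apply: le_trans (cmp_S1_lo (HC _ xy14) yS1) _.
  rewrite lee_wpmul2l ?lee_fin ?(ltW C0)//; apply: le_trans (mu_le_Haus0 d outer_mu _) _.
  by apply: cap_H0.2; apply: setSI; exact: sub_big.
have G2_lo : (q k * V)%:E <= C%:E * H2 G2.
  apply: le_trans (cmp_S2_lo (HC _ xy24) yS2) _.
  rewrite lee_wpmul2l ?lee_fin ?(ltW C0)//.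
  by apply: cap_H2.2; apply: setSI; exact: sub_big.
have pf m A (W W' : R) : (0 < W)%R -> W%:E <= C%:E * m A -> m A <= W'%:E -> posfin m A.
  move=> W0; rewrite /posfin; case: (m A) => [u||]//=.
    rewrite -EFinM lee_fin => Wu _; exists u => //.
    by move: (lt_le_trans W0 Wu); rewrite pmulr_rgt0.
  by rewrite gt0_muleNy ?lte_fin.
have pf1 : posfin H0 G1 by exact: pf G1_lo G1_up.
have pf2 : posfin H2 G2 by apply: pf G2_lo G2_up; rewrite mulr_gt0.
have sub_H0 := Haus_subadd2 d cap_mu 0.
have sub_H2 := Haus_subadd2 d cap_mu th2.
have sqC0 : (0 <= C ^+ 2)%R by rewrite exprn_ge0// ltW.
have sqC0' : (0 < C ^+ 2)%R by rewrite exprn_gt0.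
have split_X c0 : X <= (C ^+ 2)%:E * (Av H0 G1 (fun y => (`|f y - c0|)%:E) +
    Av H2 G2 (fun y => (`|f y - c0|)%:E)).
  apply: le_trans (Ecal_le_Av _ _ _ c0) _.
  apply: (@le_Av_add _ _ (C ^+ 2) a b); rewrite ?(ltW a0) ?(ltW b0)//.
  - move=> A AE; rewrite mE; apply: leeD; rewrite lee_wpmul2l ?lee_fin ?(ltW a0) ?(ltW b0)//.
      apply: le_trans (mu_le_Haus0 d outer_mu _) _; apply: cap_H0.2.
      by move=> y [yA yS]; split=> //; split=> //; apply: EB; exact: AE.
    apply: cap_H2.2.
    by move=> y [yA yS]; split=> //; split=> //; apply: EB; exact: AE.
  - apply: (@chain _ _ (a * V)%R) => //.
    by rewrite mulrCA EFinM lee_wpmul2l ?lee_fin ?(ltW a0).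
  - apply: (@chain _ _ (a * V)%R) => //.
    by rewrite abq -mulrA mulrCA EFinM lee_wpmul2l ?lee_fin ?(ltW b0).
pose A2 := Av H2 G2 (fun z => Av H0 G1 (fun y => (`|f z - f y|)%:E)).
have A20 : 0 <= A2 by exact: Av_ge0.
(* The first alternative does not involve [c0]. If it fails, the second holds for every [c0], and
   the infimum over [c0] yields an oscillation on [S2]. *)
have dich : X <= (10 * C ^+ 2)%:E * A2 \/
    forall c0, X <= (10 * C ^+ 2)%:E * Av H2 G2 (fun y => (`|f y - c0|)%:E).
  have [?|nA] := pselect (X <= (10 * C ^+ 2)%:E * A2); [by left|right=> c0].
  set v := Av H2 G2 _.
  have v0 : 0 <= v by exact: Av_ge0.
  have Xv : X <= (C ^+ 2)%:E * ((4%:E * A2 + 4%:E * v) + v).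
    apply: le_trans (split_X c0) _; rewrite lee_wpmul2l ?lee_fin// leeD2r//.
    by apply: Av_transfer => //; exact: Haus_set0.
  have [H|H] := add_dichotomy sqC0 A20 v0 Xv; [exfalso; exact: nA H|exact: H].
case: dich => [XA|XE].
- apply: Or33; split.
  + exact: le_trans (lo1 _ yS1 xy1) (CtM _ _ cap_mu).
  + exact: le_trans (lo2 _ yS2 xy2) (CtqM _).
  + move=> y xy; rewrite mV; apply: le_trans (cmp_mu (HC _ xy) sg_up) _.
    by rewrite -EFinM lee_fin ler_pM2r.
  move=> y z yS xy zS xz; apply: (le_trans XA).
  apply: (@le_trans _ _ ((10 * C ^+ 6)%:E * Ak d mu S2 S1 th2 0 (k - s) f y z)); last first.
    by rewrite lee_wpmul2r ?Av_ge0// lee_fin; exact: cC6.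
  have -> : (10 * C ^+ 6)%:E = (10 * C ^+ 2)%:E * ((C ^+ 2)%:E * (C ^+ 2)%:E) :> \bar R.
    by rewrite -!EFinM; congr _%:E; ring.
  rewrite -muleA; apply: lee_wpmul2l; first by rewrite lee_fin mulr_ge0.
  rewrite -muleA.
  pose g z0 := Av H0 (cball d z sg `&` S1) (fun y0 => (`|f z0 - f y0|)%:E).
  have mul1 (m : set T -> \bar R) (G A : set T) : A `<=` G -> m A <= 1%:E * m A.
    by move=> _; rewrite mul1e.
  have r_sg : (r <= sg <= 1)%R by apply/andP; split; [lra|exact: sg1].
  have sub_sg w (S' : set T) : (d x w <= 4 * c * r)%R ->
      cball d x (4 * c * r) `&` S' `<=` cball d w sg `&` S'.
    by move=> xw; apply: setSI; apply: (cball_sub dmet); rewrite (dist_sym dmet); lra.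
  apply: (@le_trans _ _ ((C ^+ 2)%:E * Av H2 G2 g)).
    apply: (Av_scale cap_H2 sqC0'); move=> z0 _; rewrite -[(C ^+ 2)%R]mul1r.
    apply: (le_Av_scale cap_H0 cap_H0 ltr01 sqC0 (sub_sg _ _ xz) (mul1 _ _)).
      apply: (chain _ _ V); last exact: G1_lo.
      by apply: (cmp_S1_up (HC _ xz) zS); rewrite ?sg0.
    by move=> y0 _; exact: lexx.
  apply: lee_wpmul2l; first by rewrite lee_fin.
  rewrite -[(C ^+ 2)%R]mul1r.
  apply: (le_Av_scale cap_H2 cap_H2 ltr01 sqC0 (sub_sg _ _ xy) (mul1 _ _)).
    apply: (chain _ _ (q k * V)%R); last exact: G2_lo.
    exact: (cmp_S2_up (HC _ xy) yS r_sg sg_up).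
  by move=> y0 _; exact: lexx.
- apply: Or32; split; first exact: le_trans (lo2 _ yS2 xy2) (CtqM _).
  move=> y yS xy; apply: le_Ecal => // c0; apply: (le_trans (XE c0)).
  apply: (@le_trans _ _ ((10 * C ^+ 4)%:E *
      Av (restr H2 S2) (cball d y sg) (fun z => (`|f z - c0|)%:E))); last first.
    rewrite lee_wpmul2r ?(Av_ge0 _ _ cr2) ?lee_fin//.
    by apply: cC6; rewrite ler_pM2l.
  have -> : (10 * C ^+ 4)%:E = (10 * C ^+ 2)%:E * (C ^+ 2)%:E :> \bar R.
    by rewrite -!EFinM; congr _%:E; ring.
  rewrite -muleA; apply: lee_wpmul2l; first by rewrite lee_fin mulr_ge0.
  rewrite -[(C ^+ 2)%R]mul1r; apply: (le_Av_scale cap_H2 cr2 ltr01 sqC0).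
  + move=> z [xz _]; apply: (@cball_sub _ _ _ dmet y x (4 * c * r)) xz.
    by rewrite (dist_sym dmet); lra.
  + move=> A AG; rewrite mul1e /restr; apply: cap_H2.2 => z Az.
    by split; [exact: Az|exact: (AG _ Az).2].
  + apply: (chain _ _ (q k * V)%R); last exact: G2_lo.
    apply: (cmp_S2_up (HC _ xy) yS) sg_up.
    by apply/andP; split; [lra|exact: sg1].
  by move=> y0 _; exact: lexx.
Qed.

End Local.

(** * Summation over the family *)

Section ErealTools.
Variables (R : realType) (T : Type).
Local Open Scope ereal_scope.

Lemma powR_mulN (C p : R) : (0 < C)%R -> (C `^ p * C `^ (- p) = 1)%R.
Proof. by move=> C0; rewrite powRN mulfV// gt_eqF// powR_gt0. Qed.

Lemma oint_restr (m : set T -> \bar R) (S' : set T) g :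
  oint (restr m S') setT g = oint m S' g.
Proof.
rewrite /oint; apply: eq_integral => t _; rewrite /restr; congr m.
by apply/seteqP; split=> x /= [] // [_ ?] ?.
Qed.

Lemma le_poweR (X Y : \bar R) (p : R) : (0 <= p)%R -> 0 <= X -> X <= Y -> X `^ p <= Y `^ p.
Proof.
move=> p0 X0 XY; apply: gt0_ler_poweR => //; rewrite in_itv/= ?leey ?andbT//.
exact: le_trans XY.
Qed.

Lemma poweR_invK (X : \bar R) (p : R) : (0 < p)%R -> 0 <= X -> (X `^ p^-1) `^ p = X.
Proof. by move=> p0 X0; rewrite -poweRrM mulVf ?gt_eqF// poweRe1. Qed.

Lemma poweR_dom (X Y : \bar R) (w p : R) : (0 < p)%R -> (0 < w)%R -> 0 <= X -> 0 <= Y ->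
  X <= w%:E * Y -> (w `^ (- p))%:E * X `^ p <= Y `^ p.
Proof.
move=> p0 w0 X0 Y0 XY; rewrite powRN lee_pdivrMl ?powR_gt0//.
rewrite -poweR_EFin -poweRM ?lee_fin ?(ltW w0)//; apply: le_poweR => //; exact: ltW.
Qed.

(** Only finitely many classes [kap i = k] are nonempty, so their bounds add up to a partial sum of
    the series. *)
Lemma sum_by_scale (I : finType) (P : {set I}) (kap : I -> nat) (t : I -> \bar R)
    (U : nat -> \bar R) (C : R) : (0 <= C)%R ->
  (forall i, 0 <= t i) -> (forall k, 0 <= U k) ->
  (forall i, i \in P -> (1 <= kap i)%N) ->
  (forall k, (1 <= k)%N -> \sum_(i in [set i in P | kap i == k]%SET) t i <= C%:E * U k) ->
  \sum_(i in P) t i <= C%:E * \sum_(1 <= k <oo) U k.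
Proof.
move=> C0 t0 U0 kap1 H; pose N := (\max_(i in P) kap i).+1.
apply: (@le_trans _ _ (\sum_(1 <= k < N) C%:E * U k)); last first.
  rewrite -ge0_sume_distrr// lee_wpmul2l ?lee_fin//.
  exact: nneseries_lim_ge.
apply: (@le_trans _ _ (\sum_(1 <= k < N) \sum_(i in [set i in P | kap i == k]%SET) t i)); last first.
  by rewrite !big_nat; apply: lee_sum => k /andP[k1 _]; exact: H.
under [leRHS]eq_bigr => k _.
  rewrite (eq_bigl (fun i => (i \in P) && (kap i == k))); last by move=> i; rewrite inE.
  rewrite big_mkcondr; over.
rewrite exchange_big/=; apply: lee_sum => i iP.
rewrite (bigD1_seq (kap i)) ?iota_uniq//=; last first.
  by rewrite mem_index_iota kap1//= ltnS; exact: leq_bigmax_cond.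
by rewrite eqxx leeDl// sume_ge0// => k _; case: ifP.
Qed.

End ErealTools.

Section Sums.
Variables (R : realType) (T : Type) (d : T -> T -> R).
Hypothesis dmet : is_metric d.
Variable mu : set T -> \bar R.
Hypothesis outer_mu : is_outer_measure mu.
Hypothesis borel_mu : borel_regular d mu.
Hypothesis locfin_mu : locally_finite d mu.
Hypothesis supp_mu : supp d mu = setT.
Hypothesis doubling_mu : unif_loc_doubling d mu.
Variables (p th2 th : R) (S1 S2 : set T).
Hypothesis p1 : 1 < p.
Hypothesis th20 : 0 < th2.
Hypothesis th2th : th2 <= th.
Hypothesis ADR1 : ADR d mu 0 S1.
Hypothesis ADR2 : ADR d mu th2 S2.
Variables (c : R) (s : nat).
Hypothesis c1 : 1 <= c.
Hypothesis s_c : 8 * c <= 2 ^+ s.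
Local Open Scope ereal_scope.

Let cap_mu := outer_capacity outer_mu.
Let cap_H0 := Haus_capacity d cap_mu 0.
Let cap_H2 := Haus_capacity d cap_mu th2.
Let p0 : (0 < p)%R. Proof. by have := p1; lra. Qed.
Let c41 : (1 <= 4 * c)%R. Proof. by have := c1; lra. Qed.

Local Notation H0 := (Haus d mu 0).
Local Notation H2 := (Haus d mu th2).
Local Notation q k := (2 `^ (k%:R * th2))%R.
Local Notation mk k := (mk_seq d mu th th2 S1 S2 k).

Definition term x (r : R) (X : \bar R) := mu (cball d x r) * (r `^ (- p))%:E * X `^ p.

Lemma term_ge0 x r X : 0 <= term x r X.
Proof. by rewrite !mule_ge0 ?poweR_ge0 ?cap_mu.1// lee_fin powR_ge0. Qed.

Lemma term_scale x r X (C w : R) : (0 <= w)%R -> (r `^ (- p) <= C * w)%R ->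
  term x r X <= C%:E * (mu (cball d x r) * (w%:E * X `^ p)).
Proof.
move=> w0 H; rewrite /term -muleA [leRHS]muleCA lee_wpmul2l ?cap_mu.1// [leRHS]muleA -EFinM.
by rewrite lee_wpmul2r ?poweR_ge0// lee_fin.
Qed.

Lemma sum_fsharp (C : R) : (0 < C)%R -> exists2 C' : R, (0 < C')%R &
  forall (I : finType) (x : I -> T) (r : I -> R) (X : I -> \bar R) (P : {set I}) f,
  disjoint_balls d x r -> (forall i, 0 < r i <= 1)%R -> (forall i, 0 <= X i) ->
  (forall i, i \in P -> fsharp_dominated d mu S1 c C f (x i) (r i) (X i)) ->
  \sum_(i in P) term (x i) (r i) (X i) <=
  C'%:E * oint mu S1 (fun y => fsharp d mu S1 f y `^ p).
Proof.
move=> C0; have [Cv Cv0 HCv] := carleson_sum dmet outer_mu borel_mu doubling_mu c41.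
exists (C `^ p * (Cv * C))%R; first by rewrite !mulr_gt0// powR_gt0.
move=> I x r X P f disj r01 X0 dom.
(* The negative power of [r i] in [term] cancels the radius in the bound on [X i], so all scales are
   summed at once, without a series over [k]. *)
pose a i := ((C * r i) `^ (- p))%:E * X i `^ p.
apply: (@le_trans _ _ ((C `^ p)%:E * \sum_(i in P) mu (cball d (x i) (r i)) * a i)).
  rewrite ge0_sume_distrr; last first.
    by move=> i _; rewrite !mule_ge0 ?cap_mu.1 ?poweR_ge0// lee_fin powR_ge0.
  apply: lee_sum => i _; apply: term_scale; rewrite ?powR_ge0//.
  have /andP[ri0 _] := r01 i.
  by rewrite powRM ?(ltW C0) ?(ltW ri0)// mulrA powR_mulN// mul1r.
rewrite EFinM -muleA lee_wpmul2l ?lee_fin ?powR_ge0//.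
apply: HCv => //; [exact: outer_gap_superadd|exact: ltW| |].
  by move=> i /dom[].
move=> i y /dom[_ H] iy yS; have /andP[ri0 _] := r01 i.
apply: poweR_dom => //; first by rewrite mulr_gt0.
  exact: fsharp_ge0.
exact: H.
Qed.

(** Balls of scale [k + s] are charged to the [k]-th term of the Besov series. Their factor of order
    2^((k+s) p), divided by [q (k + s)] for the mass on [S2], is the weight 2^(k (p - th2)) of that
    term times the constant 2^(s (p - th2)). *)
Lemma sum_besov_scale (C : R) : (0 < C)%R -> exists2 C' : R, (0 < C')%R &
  forall (I : finType) (x : I -> T) (r : I -> R) (X : I -> \bar R) (P : {set I}) f k,
  disjoint_balls d x r -> (forall i, 0 < r i <= 1)%R -> (forall i, 0 <= X i) ->
  (forall i, i \in P -> at_scale (r i) (k + s)) ->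
  (forall i, i \in P -> besov_dominated d mu th2 S2 c s C f (x i) (r i) (k + s) (X i)) ->
  \sum_(i in P) term (x i) (r i) (X i) <=
  C'%:E * ((2 `^ (k%:R * (1 - th2 / p) * p))%:E *
    oint H2 S2 (fun y => Ecal (restr H2 S2) f (cball d y (2 ^- k)) `^ p)).
Proof.
move=> C0; have [Cv Cv0 HCv] := carleson_sum dmet outer_mu borel_mu doubling_mu c41.
pose D := (2 `^ p * C `^ p * (Cv * C) * 2 `^ (s%:R * (p - th2)))%R.
exists D; first by rewrite /D !mulr_gt0// powR_gt0.
move=> I x r X P f k disj r01 X0 sc dom.
set o := oint _ _ _.
pose K := (2 `^ p * 2 `^ ((k + s)%:R * p) * C `^ p)%R.
have K0 : (0 <= K)%R by rewrite !mulr_ge0// powR_ge0.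
apply: (@le_trans _ _ (K%:E * \sum_(i in P) mu (cball d (x i) (r i)) * ((C `^ (- p))%:E * X i `^ p))).
  rewrite ge0_sume_distrr; last first.
    by move=> i _; rewrite !mule_ge0 ?cap_mu.1 ?poweR_ge0// lee_fin powR_ge0.
  apply: lee_sum => i iP; apply: term_scale; rewrite ?powR_ge0//.
  have [_ /andP[H _]] := sc _ iP.
  by rewrite /K -mulrA powR_mulN// mulr1; apply: dyadic_powR_ge => //; exact: ltW.
have -> : D%:E * ((2 `^ (k%:R * (1 - th2 / p) * p))%:E * o) =
    K%:E * ((Cv * (C / q (k + s)%N))%:E * o).
  rewrite !muleA -!EFinM; congr (_%:E * _).
  have -> : (k%:R * (1 - th2 / p) * p = k%:R * (p - th2))%R.
    by rewrite -mulrA mulrBl mul1r divfK ?gt_eqF.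
  rewrite -powRN /D /K.
  have E : (2 `^ (s%:R * (p - th2)) * 2 `^ (k%:R * (p - th2)) =
     2 `^ ((k + s)%:R * p) * 2 `^ (- ((k + s)%:R * th2)) :> R)%R.
    by rewrite -!powRD; [congr (_ `^ _)%R; rewrite natrD; ring|apply/implyP..].
  by rewrite -(mulrA _ (2 `^ (s%:R * (p - th2)))%R) E; ring.
rewrite lee_wpmul2l ?lee_fin//; apply: HCv => //.
- exact: Haus_gap_superadd.
- by rewrite mulr_ge0 ?invr_ge0 ?powR_ge0// ltW.
- by move=> i /dom[].
move=> i y /dom[_ H] iy yS; apply: poweR_dom => //.
  by apply: Ecal_ge0; exact: restr_capacity.
by have := H y yS iy; rewrite addnK.
Qed.

Lemma wk_ge (C V : R) k y z : (0 < V)%R -> (0 < C)%R ->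
  mu (cball d y (2 ^- k)) <= (C * V)%:E -> mu (cball d z (2 ^- k)) <= (C * V)%:E ->
  ((C * V)^-1)%:E <= wk d mu k y z.
Proof.
move=> V0 C0 Hy Hz; rewrite /wk lee_fin.
have r0 : (0 < 2 ^- k :> R)%R by rewrite invr_gt0 exprn_gt0.
have [a a0 ma] := ball_posfin dmet outer_mu locfin_mu supp_mu doubling_mu y r0.
have [b b0 mb] := ball_posfin dmet outer_mu locfin_mu supp_mu doubling_mu z r0.
move: Hy Hz; rewrite ma mb !lee_fin => aV bV; rewrite -EFinM/=.
have W0 : (0 < C * V)%R by rewrite mulr_gt0.
have ab0 : (0 < a * b)%R by rewrite mulr_gt0.
rewrite powRN lef_pV2 ?posrE ?powR_gt0//.
have -> : (C * V = (C * V * (C * V)) `^ 2^-1)%R.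
  by rewrite powRM ?(ltW W0)// powR12_sqrt ?(ltW W0)// -expr2 sqr_sqrtr// ltW.
apply: ge0_ler_powR; rewrite ?nnegrE ?invr_ge0 ?(ltW ab0) ?(ltW (mulr_gt0 W0 W0))//.
by apply: ler_pM => //; exact: ltW.
Qed.

(** [carleson_sum] is applied on [S1]; its integrand at [z] is the whole inner integral over [S2],
    bounded below by restricting it to the dilated ball. *)
Lemma sum_gluing_scale (C : R) : (0 < C)%R -> exists2 C' : R, (0 < C')%R &
  forall (I : finType) (x : I -> T) (r : I -> R) (X : I -> \bar R) (P : {set I}) f k,
  disjoint_balls d x r -> (forall i, 0 < r i <= 1)%R -> (forall i, 0 <= X i) ->
  (forall i, i \in P -> at_scale (r i) (k + s)) ->
  (forall i, i \in P -> gluing_dominated d mu th2 S1 S2 c s C f (x i) (r i) (k + s) (X i)) ->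
  \sum_(i in P) term (x i) (r i) (X i) <=
  C'%:E * ((2 `^ (k%:R * (p - th2 - 0)))%:E *
    oint H0 S1 (fun z => oint H2 [set y | S2 y /\ (d y z <= 2 ^- k)%R]
      (fun y => wk d mu k y z * Ak d mu S2 S1 th2 0 k f y z `^ p))).
Proof.
move=> C0; have [Cv Cv0 HCv] := carleson_sum dmet outer_mu borel_mu doubling_mu c41.
pose D := (2 `^ p * C `^ p * (C * C) * (Cv * C) * 2 `^ (s%:R * (p - th2)))%R.
exists D; first by rewrite /D !mulr_gt0// powR_gt0.
move=> I x r X P f k disj r01 X0 sc dom.
set g := (fun z => _); set o := oint _ _ _.
have q0 : (0 < q (k + s)%N)%R by rewrite powR_gt0.
(* Product of three lower bounds: 1/(C V) for [wk], C^(-p) for the ratio of the p-th powers of [Ak]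
   and [X i], and [q (k + s) * V / C] for the mass on [S2]. The mass [V] of the ball cancels. *)
pose w := (q (k + s)%N * (C * C)^-1 * C `^ (- p))%R.
have w0 : (0 <= w)%R by rewrite !mulr_ge0 ?powR_ge0 ?invr_ge0 ?mulr_ge0 ?(ltW C0).
pose K := (2 `^ p * 2 `^ ((k + s)%:R * p) * C `^ p * (C * C) / q (k + s)%N)%R.
have K0 : (0 <= K)%R by rewrite !mulr_ge0 ?invr_ge0 ?powR_ge0 ?(ltW C0).
have Kw : (K * w = 2 `^ p * 2 `^ ((k + s)%:R * p))%R.
  rewrite /K /w; have := powR_mulN p C0; move: (C `^ p)%R (C `^ (- p))%R => u v uv.
  transitivity (2 `^ p * 2 `^ ((k + s)%:R * p) * (u * v))%R; last by rewrite uv mulr1.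
  by field; rewrite (gt_eqF C0) (gt_eqF q0).
apply: (@le_trans _ _ (K%:E * \sum_(i in P) mu (cball d (x i) (r i)) * (w%:E * X i `^ p))).
  rewrite ge0_sume_distrr; last first.
    by move=> i _; rewrite !mule_ge0 ?cap_mu.1 ?poweR_ge0// lee_fin.
  apply: lee_sum => i iP; apply: term_scale => //.
  have [_ /andP[H _]] := sc _ iP.
  by rewrite Kw; apply: dyadic_powR_ge => //; exact: ltW.
have -> : D%:E * ((2 `^ (k%:R * (p - th2 - 0)))%:E * o) = K%:E * ((Cv * C)%:E * o).
  rewrite !muleA -!EFinM; congr (_%:E * _).
  rewrite subr0 /D /K -powRN.
  have E : (2 `^ (s%:R * (p - th2)) * 2 `^ (k%:R * (p - th2)) =
     2 `^ ((k + s)%:R * p) * 2 `^ (- ((k + s)%:R * th2)) :> R)%R.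
    by rewrite -!powRD; [congr (_ `^ _)%R; rewrite natrD; ring|apply/implyP..].
  by rewrite -(mulrA _ (2 `^ (s%:R * (p - th2)))%R) E; ring.
apply: lee_wpmul2l; first by rewrite lee_fin.
apply: HCv => //.
- exact: Haus_gap_superadd.
- exact: ltW.
- move=> i /dom[H _ _ _]; apply: (le_trans H).
  by apply: lee_wpmul2l; [rewrite lee_fin ltW|exact: mu_le_Haus0].
move=> i z iP xz zS; have [_ lo2 up H] := dom _ iP.
have [/andP[ri0 _] /andP[_ rk]] := sc _ iP.
have [V V0 mV] := ball_posfin dmet outer_mu locfin_mu supp_mu doubling_mu (x i) ri0.
rewrite addnK in up H; rewrite mV -EFinM in up; rewrite mV in lo2.
set G2 := cball d (x i) (4 * c * r i) `&` S2 in lo2.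
have sg_lo : (8 * c * r i <= 2 ^- k)%R.
  have -> : (2 ^- k = 2 ^+ s * 2 ^- (k + s) :> R)%R.
    by rewrite exprD invfM mulrCA mulfV ?mulr1// gt_eqF// exprn_gt0.
  by have c1' := c1; apply: ler_pM => //; lra.
apply: (@le_trans _ _ ((((C * V)^-1)%:E * ((C `^ (- p))%:E * X i `^ p)) * H2 G2)).
  have {}lo2 : (q (k + s)%N * V / C)%:E <= H2 G2.
    move: lo2; rewrite [(C / _)%R]mulrC EFinM -muleA lee_pdivlMl// => lo2.
    by rewrite mulrC EFinM lee_pdivrMl// EFinM.
  apply: (@le_trans _ _ ((((C * V)^-1)%:E * ((C `^ (- p))%:E * X i `^ p)) *
      (q (k + s)%N * V / C)%:E)); last first.
    apply: lee_wpmul2l => //; rewrite !mule_ge0 ?poweR_ge0 ?lee_fin ?powR_ge0//.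
    by rewrite invr_ge0 mulr_ge0 ?(ltW C0) ?(ltW V0).
  rewrite [leRHS]muleC !muleA -!EFinM lee_wpmul2r ?poweR_ge0// lee_fin /w.
  rewrite le_eqVlt; apply/orP; left; apply/eqP; field.
  by rewrite !gt_eqF.
apply: (@le_trans _ _ (oint H2 G2 (fun y => wk d mu k y z * Ak d mu S2 S1 th2 0 k f y z `^ p))).
  apply: oint_ge_cst => // y [xy yS]; apply: lee_pmul.
  - by rewrite lee_fin invr_ge0 mulr_ge0 ?(ltW C0) ?(ltW V0).
  - by rewrite mule_ge0 ?poweR_ge0// lee_fin powR_ge0.
  - by apply: wk_ge => //; exact: up.
  - apply: poweR_dom => //; first exact: Av_ge0.
    exact: H.
(* Two points of the dilated ball are at distance at most [8 * c * r i <= 2 ^- k], hence in the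
   domain of the gluing integral. *)
apply: le_oint => // y [xy yS]; split=> //.
have := dist_tri dmet y (x i) z; rewrite (dist_sym dmet y (x i)).
by move: xy xz sg_lo; rewrite /cball/=; lra.
Qed.

Lemma oint_mk_le (Wd : R) k G g : (0 <= Wd)%R -> (2 `^ (k%:R * th) <= Wd)%R ->
  (2 `^ (k%:R * (th - th2)) <= Wd)%R ->
  oint (mk k) G g <= Wd%:E * (oint mu (G `&` S1) g + oint H2 (G `&` S2) g).
Proof.
move=> Wd0 aW bW; rewrite ge0_muleDr ?oint_ge0//.
apply: le_oint_add => //; first exact: mk_capacity.
move=> t t0; rewrite /layer mk_seqE; apply: leeD.
  apply: lee_pmul; rewrite ?lee_fin ?powR_ge0 ?cap_mu.1//.
  by apply: cap_mu.2 => y [[? ?] ?].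
apply: lee_pmul; rewrite ?lee_fin ?powR_ge0 ?cap_H2.1//.
by apply: cap_H2.2 => y [[? ?] ?].
Qed.

(** A factor dominated by the total mass undoes the normalization of the mean. *)
Lemma Av_absorb (m : set T -> \bar R) G g (V C : R) : capacity m -> (0 <= C)%R ->
  V%:E <= C%:E * m G -> V%:E * Av m G g <= C%:E * oint m G g.
Proof.
move=> cm C0 VC; have o0 := oint_ge0 G g cm.
have [->|[b [b0 mG]] ->] := Av_cases G cm; first by rewrite mule0 mule_ge0.
rewrite muleA -EFinM; apply: lee_wpmul2r => //; rewrite lee_fin ler_pdivrMr//.
by move: VC; rewrite mG -EFinM lee_fin.
Qed.

(** At the finitely many scales up to [s], the weights of [mk], the negative powers of [r i] and the
    overlap of the dilates are bounded by constants, so taking the constant [0] in the oscillation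
    loses nothing essential. *)
Lemma sum_large : inhabited T -> exists2 C' : R, (0 < C')%R &
  forall (I : finType) (x : I -> T) (r : I -> R) (P : {set I}) (kap : I -> nat) f,
  disjoint_balls d x r -> (forall i, 0 < r i <= 1)%R ->
  (forall i, at_scale (r i) (kap i)) -> (forall i, i \in P -> (kap i <= s)%N) ->
  (forall i, exists y, (S1 `|` S2) y /\ (d (x i) y <= c * r i)%R) ->
  \sum_(i in P) term (x i) (r i) (Ecal (mk (kap i)) f (cball d (x i) (2 * (c * r i)))) <=
  C'%:E * (oint mu S1 (fun y => (`|f y|)%:E `^ p) + oint H2 S2 (fun y => (`|f y|)%:E `^ p)).
Proof.
move=> inT.
have [C C1 HC] := comparable_near dmet outer_mu borel_mu locfin_mu supp_mu doubling_mu
  th20 ADR1 ADR2 s_c.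
have C0 : (0 < C)%R by lra.
have th0 : (0 <= th)%R by have := th2th; have := th20; lra.
have c21 : (1 <= 2 * c)%R by have := c1; lra.
have r00 : (0 < 2 ^- s.+1 :> R)%R by rewrite invr_gt0 exprn_gt0.
have [n Hn] := large_overlap dmet outer_mu borel_mu locfin_mu supp_mu doubling_mu c21 r00.
pose Wd := (2 `^ (s%:R * th) : R)%R.
have Wd0 : (0 < Wd)%R by rewrite powR_gt0.
pose rp := (2 `^ p * 2 `^ (s%:R * p) : R)%R.
have rp0 : (0 < rp)%R by rewrite mulr_gt0 ?powR_gt0.
pose K := (rp * 2 `^ p * C * Wd)%R.
have K0 : (0 < K)%R by rewrite !mulr_gt0// powR_gt0.
(* The overlap bound [n] may be [0]; its successor keeps the constant positive. *)
exists (K * n.+1%:R)%R; first by rewrite mulr_gt0.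
move=> I x r P kap f disj r01 sc ks nearS.
pose g y := (`|f y|)%:E `^ p : \bar R.
pose o i := oint mu (cball d (x i) (2 * c * r i) `&` S1) g +
  oint H2 (cball d (x i) (2 * c * r i) `&` S2) g.
have o0 i : 0 <= o i by apply: adde_ge0; exact: oint_ge0.
apply: (@le_trans _ _ (K%:E * \sum_(i in P) o i)); last first.
  rewrite [(K * n.+1%:R)%:E]EFinM -muleA; apply: lee_wpmul2l; first by rewrite lee_fin ltW.
  rewrite big_split/= ge0_muleDr ?oint_ge0//; apply: leeD.
  - apply: (@le_trans _ _ (n%:R%:E * oint mu S1 g)).
      apply: Hn => //; first exact: outer_gap_superadd.
      move=> i iP; have [_ /andP[H _]] := sc i; apply: le_trans (ltW H).
      by rewrite lef_pV2 ?posrE ?exprn_gt0// ler_weXn2l ?ler1n// ltnS ks.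
    by apply: lee_wpmul2r; [exact: oint_ge0|rewrite lee_fin ler_nat].
  - apply: (@le_trans _ _ (n%:R%:E * oint H2 S2 g)).
      apply: Hn => //; first exact: Haus_gap_superadd.
      move=> i iP; have [_ /andP[H _]] := sc i; apply: le_trans (ltW H).
      by rewrite lef_pV2 ?posrE ?exprn_gt0// ler_weXn2l ?ler1n// ltnS ks.
    by apply: lee_wpmul2r; [exact: oint_ge0|rewrite lee_fin ler_nat].
rewrite ge0_sume_distrr; last by move=> i _; exact: o0.
apply: lee_sum => i iP; have ki := ks _ iP.
have [/andP[ri0 ri1] /andP[rk1 rk2]] := sc i.
set E := cball d (x i) _; set X := Ecal _ _ _.
have [V V0 mV] := ball_posfin dmet outer_mu locfin_mu supp_mu doubling_mu (x i) ri0.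
have cm : capacity (mk (kap i)) by exact: mk_capacity.
have X0 : 0 <= X by exact: Ecal_ge0.
have Vm : V%:E <= C%:E * mk (kap i) E.
  apply: le_trans (mk_lower dmet outer_mu th c1 C0 ri0 (HC _ _ _ _ (sc i) mV V0) (nearS i)).
  rewrite lee_fin ler_peMl ?(ltW V0)// -[leLHS](powRr0 2); apply: ler_powR; first by rewrite ler1n.
  by rewrite mulr_ge0.
have Xp : X `^ p <= (2 `^ p)%:E * Av (mk (kap i)) E g.
  apply: (@le_trans _ _ (Av (mk (kap i)) E (fun y => (`|f y|)%:E) `^ p)).
    apply: le_poweR => //; first exact: ltW.
    apply: le_trans (Ecal_le_Av _ _ _ 0%R) _; apply: le_Av => // y _.
    by rewrite subr0.
  apply: Av_powR => //; first exact: mk_subadd2.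
  exact: mk_set0.
have rpi : (r i `^ (- p) <= rp)%R.
  apply: dyadic_powR_ge; first exact: ltW.
  apply: le_lt_trans rk1.
  by rewrite lef_pV2 ?posrE ?exprn_gt0// ler_weXn2l ?ler1n// ltnS.
rewrite /term mV.
apply: (@le_trans _ _ (V%:E * rp%:E * ((2 `^ p)%:E * Av (mk (kap i)) E g))).
  apply: lee_pmul => //.
  - by rewrite mule_ge0// lee_fin ?powR_ge0// ltW.
  - exact: poweR_ge0.
  - by apply: lee_wpmul2l; rewrite lee_fin// ltW.
have -> : V%:E * rp%:E * ((2 `^ p)%:E * Av (mk (kap i)) E g) =
    (rp * 2 `^ p)%:E * (V%:E * Av (mk (kap i)) E g).
  by rewrite !muleA -!EFinM; congr (_%:E * _); ring.
have -> : K%:E * o i = (rp * 2 `^ p)%:E * (C%:E * (Wd%:E * o i)).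
  by rewrite !muleA -!EFinM.
apply: lee_wpmul2l; first by rewrite lee_fin mulr_ge0 ?powR_ge0 ?(ltW rp0).
apply: le_trans (Av_absorb _ cm (ltW C0) Vm) _.
apply: lee_wpmul2l; first by rewrite lee_fin ltW.
have -> : E = cball d (x i) (2 * c * r i) by rewrite /E mulrA.
have kth : ((kap i)%:R * th <= s%:R * th)%R by rewrite ler_wpM2r// ler_nat.
apply: oint_mk_le; first exact: ltW.
  by apply: ler_powR => //; rewrite ler1n.
apply: ler_powR; first by rewrite ler1n.
apply: le_trans kth; rewrite ler_wpM2l//.
by have := th20; lra.
Qed.

End Sums.

(** * Assembly of the four partial sums *)

Theorem theorem3p19 (R : realType) (T : Type) (d : T -> T -> R)
    (mu : set T -> \bar R) (p th2 th : R) (S1 S2 : set T) :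
  is_metric d -> is_complete d -> is_separable d ->
  is_outer_measure mu -> borel_regular d mu -> locally_finite d mu ->
  supp d mu = setT -> unif_loc_doubling d mu ->
  1 < p -> weak_local_poincare d mu p ->
  0 < th2 -> th2 < p -> (th2%:E < Qlow d mu)%E ->
  th2 <= th -> th < p ->
  ADR d mu 0 S1 -> ADR d mu th2 S2 ->
  forall c : R, 1 <= c -> exists C : R, 0 < C /\
    forall f : T -> R,
      inLp p (restr (Haus d mu 0) S1) f ->
      inLp p (restr (Haus d mu th2) S2) f ->
      (BSN d mu (S1 `|` S2) p (mk_seq d mu th th2 S1 S2) c f <=
       C%:E * (LpnormE p (restr mu S1) (fsharp d mu S1 f) +
               Lpnorm p (restr mu S1) f +
               Besov_norm d mu th2 p (1 - th2 / p) S2 f +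
               GL3 d mu p th2 S1 S2 f))%E.
Proof.
move=> dmet _ _ outer_mu borel_mu locfin_mu supp_mu doubling_mu p1 _ th20 _ _ th2th _ ADR1 ADR2 c c1.
have p0 : 0 < p by lra.
have cap_mu := outer_capacity outer_mu.
have cap_H0 := Haus_capacity d cap_mu 0.
have cap_H2 := Haus_capacity d cap_mu th2.
(* In an empty space every family is empty and the functional vanishes. The case is set apart
   because [Haus] of the empty set is [+oo] there. *)
have [inT|noT] := pselect (inhabited T); last first.
  exists 1; split=> // f _ _; apply/ereal_supP => v [M [x [r [_ ->]]]].
  rewrite big1 ?poweR0r ?invr_eq0 ?gt_eqF//; last by move=> i _; case: noT; exists; exact: x i.
  by rewrite mul1e !adde_ge0 ?poweR_ge0.
have [s s_c] := two_pow_gt (8 * c).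
have [C C0 HC] := local_estimate dmet outer_mu borel_mu locfin_mu supp_mu doubling_mu
  th th20 ADR1 ADR2 c1 s_c inT.
have [CF CF0 HF] := sum_fsharp dmet outer_mu borel_mu doubling_mu S1 p1 c1 C0.
have [CB CB0 HB] := sum_besov_scale dmet outer_mu borel_mu doubling_mu th2 S2 p1 s c1 C0.
have [CG CG0 HG] := sum_gluing_scale dmet outer_mu borel_mu locfin_mu supp_mu doubling_mu
  th2 S1 S2 p1 c1 s_c C0.
have [CL CL0 HL] := sum_large dmet outer_mu borel_mu locfin_mu supp_mu doubling_mu
  p1 th20 th2th ADR1 ADR2 c1 s_c inT.
(* The large balls are charged to two integrals, over [S1] and [S2], each at most the p-th power of
   [W]; hence [2 * CL]. *)
pose Ctot := 2 * CL + CF + CB + CG.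
have Ctot0 : 0 < Ctot by rewrite /Ctot; lra.
exists (Ctot `^ p^-1); split; first by rewrite powR_gt0.
move=> f _ _; apply/ereal_supP => v [M [x [r [[r01 [disj nearS]] ->]]]].
set oF := LpnormE _ _ _; set o1 := Lpnorm _ _ _; set B := Besov_norm _ _ _ _ _ _ _.
set G := GL3 _ _ _ _ _ _ _.
pose W := (oF + o1 + B + G)%E; rewrite -/W.
have [oF0 o10 G0] : [/\ 0 <= oF, 0 <= o1 & 0 <= G]%E by split; exact: poweR_ge0.
have B0 : (0 <= B)%E by apply: adde_ge0; exact: poweR_ge0.
have [oFW o1W BW GW] : [/\ oF <= W, o1 <= W, B <= W & G <= W]%E.
  split.
  - by apply: le_trans (leeDl _ G0); apply: le_trans (leeDl _ B0); exact: leeDl.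
  - by apply: le_trans (leeDl _ G0); apply: le_trans (leeDl _ B0); exact: leeDr.
  - by apply: le_trans (leeDl _ G0); apply: leeDr; exact: adde_ge0.
  - by apply: leeDr; apply: adde_ge0 => //; exact: adde_ge0.
have W0 : (0 <= W)%E by exact: le_trans oFW.
have rootW (o : \bar R) : (0 <= o -> o `^ p^-1 <= W -> o <= W `^ p)%E.
  move=> o0 oW; rewrite -(poweR_invK p0 o0); apply: le_poweR => //; first exact: ltW.
  exact: poweR_ge0.
pose kap i := kr (r i).
have sc i : at_scale (r i) (kap i) by split; [exact: r01|exact: kr_spec].
pose X i := Ecal (mk_seq d mu th th2 S1 S2 (kap i)) f (cball d (x i) (2 * (c * r i))).
have X0 i : (0 <= X i)%E by apply: Ecal_ge0; exact: mk_capacity.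
pose t i := term d mu p (x i) (r i) (X i).
have t0 i : (0 <= t i)%E by exact: term_ge0.
have -> : (\sum_(i < M) mu (cball d (x i) (r i)) * ((r i) `^ (- p))%:E *
    Etilde d (S1 `|` S2) (mk_seq d mu th th2 S1 S2 (kr (r i))) f (x i) (c * r i) `^ p =
    \sum_(i < M) t i)%E.
  by apply: eq_bigr => i _; rewrite /Etilde (asboolT (nearS i)).
pose isF i := fsharp_dominated d mu S1 c C f (x i) (r i) (X i).
pose isB i := besov_dominated d mu th2 S2 c s C f (x i) (r i) (kap i) (X i).
pose isG i := gluing_dominated d mu th2 S1 S2 c s C f (x i) (r i) (kap i) (X i).
pose PL := [set i | (kap i <= s)%N]%SET.
pose PF := [set i | `[< isF i >]]%SET.
pose PB := [set i | (s < kap i)%N && `[< isB i >]]%SET.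
pose PG := [set i | (s < kap i)%N && `[< isG i >]]%SET.
(* The classes may overlap, whence an inequality; [local_estimate] places every index with
   [s < kap i] in one of the last three. *)
have cover : (\sum_(i < M) t i <= \sum_(i in PL) t i + \sum_(i in PF) t i +
    \sum_(i in PB) t i + \sum_(i in PG) t i)%E.
  rewrite (big_mkcond (mem PL)) (big_mkcond (mem PF)) (big_mkcond (mem PB)) (big_mkcond (mem PG)).
  rewrite -!big_split/=; apply: lee_sum => i _.
  have ge0 (b : bool) : (0 <= if b then t i else 0)%E by case: b.
  have [ks|sk] := leqP (kap i) s.
    rewrite {1}/PL inE ks -!addeA; apply: leeDl; do 2?[apply: adde_ge0 => //]; exact: ge0.
  have [F|B'|G'] := HC f (x i) (r i) (kap i) (sc i) sk (nearS i).
  - rewrite [i \in PF]inE (asboolT F) [X in (X + _ + _ + _)%E]/=.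
    rewrite -addeA; apply: le_trans (leeDl _ _); last by apply: adde_ge0; exact: ge0.
    by apply: leeDr; exact: ge0.
  - rewrite [i \in PB]inE sk (asboolT B')/=; apply: le_trans (leeDl _ (ge0 _)).
    by apply: leeDr; apply: adde_ge0; exact: ge0.
  - rewrite [i \in PG]inE sk (asboolT G')/=; apply: leeDr.
    by do 2?[apply: adde_ge0]; exact: ge0.
have WL : (\sum_(i in PL) t i <= (2 * CL)%:E * W `^ p)%E.
  apply: le_trans (HL _ x r PL kap f disj r01 sc _ nearS) _.
    by move=> i; rewrite inE.
  rewrite mulrC EFinM -muleA; apply: lee_wpmul2l; first by rewrite lee_fin ltW.
  rewrite -[2]/(1 + 1) EFinD ge0_muleDl ?mul1e ?lee_fin//; apply: leeD; apply: rootW.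
  - exact: oint_ge0.
  - by rewrite -oint_restr.
  - exact: oint_ge0.
  (* The L_p norm on [S2] is the first summand of the Besov norm. *)
  - by rewrite -oint_restr; apply: le_trans BW; apply: leeDl; exact: poweR_ge0.
have WF : (\sum_(i in PF) t i <= CF%:E * W `^ p)%E.
  apply: le_trans (HF _ x r X PF f disj r01 X0 _) _.
    by move=> i; rewrite inE => /asboolP.
  apply: lee_wpmul2l; first by rewrite lee_fin ltW.
  by apply: rootW; [exact: oint_ge0|rewrite -oint_restr].
have scale_eq i k : (s < kap i)%N -> (kap i - s)%N == k -> kap i = (k + s)%N.
  by move=> sk /eqP <-; rewrite subnK// ltnW.
have WB : (\sum_(i in PB) t i <= CB%:E * W `^ p)%E.
  apply: (@le_trans _ _ (CB%:E * \sum_(1 <= k <oo) ((2 `^ (k%:R * (1 - th2 / p) * p))%:E *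
      oint (Haus d mu th2) S2
        (fun y => Ecal (restr (Haus d mu th2) S2) f (cball d y (2 ^- k)) `^ p)))%E).
    apply: (sum_by_scale (kap := fun i => kap i - s)%N) => //; first exact: ltW.
    - by move=> k; rewrite mule_ge0 ?oint_ge0// lee_fin powR_ge0.
    - by move=> i; rewrite inE subn_gt0 => /andP[].
    move=> k _; apply: HB => // i; rewrite !inE => /andP[/andP[sk /asboolP iB] /(scale_eq _ _ sk) E].
      by rewrite -E.
    by rewrite -E.
  apply: lee_wpmul2l; first by rewrite lee_fin ltW.
  apply: rootW; last by apply: le_trans BW; apply: leeDr; exact: poweR_ge0.
  by apply: nneseries_ge0 => k _ _; rewrite mule_ge0 ?oint_ge0// lee_fin powR_ge0.
have GLterm0 Si Sj thi thj : (0 <= GLterm d mu p Si Sj thi thj f)%E.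
  apply: nneseries_ge0 => k _ _; rewrite mule_ge0 ?lee_fin ?powR_ge0//.
  by apply: oint_ge0; exact: Haus_capacity.
have WG : (\sum_(i in PG) t i <= CG%:E * W `^ p)%E.
  apply: (@le_trans _ _ (CG%:E * GLterm d mu p S2 S1 th2 0 f)%E).
    apply: (sum_by_scale (kap := fun i => kap i - s)%N) => //; first exact: ltW.
    - by move=> k; rewrite mule_ge0 ?oint_ge0// lee_fin powR_ge0.
    - by move=> i; rewrite inE subn_gt0 => /andP[].
    move=> k _; apply: HG => // i; rewrite !inE => /andP[/andP[sk /asboolP iG] /(scale_eq _ _ sk) E].
      by rewrite -E.
    by rewrite -E.
  apply: lee_wpmul2l; first by rewrite lee_fin ltW.
  apply: rootW => //; apply: le_trans GW; apply: le_poweR => //.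
    by rewrite invr_ge0 ltW.
  exact: leeDr.
have VW : (\sum_(i < M) t i <= Ctot%:E * W `^ p)%E.
  have mulD (a b : R) : 0 <= a -> 0 <= b ->
      ((a + b)%:E * W `^ p = a%:E * W `^ p + b%:E * W `^ p)%E.
    by move=> a0 b0; rewrite EFinD ge0_muleDl.
  apply: (le_trans cover); rewrite /Ctot !mulD ?addr_ge0 ?mulr_ge0 ?(ltW CL0) ?(ltW CF0) ?(ltW CB0) ?(ltW CG0)//.
  exact: leeD (leeD (leeD WL WF) WB) WG.
apply: (@le_trans _ _ ((Ctot%:E * W `^ p) `^ p^-1)%E).
  by apply: le_poweR => //; [rewrite invr_ge0 ltW|apply: sume_ge0].
rewrite poweRM ?poweR_ge0 ?lee_fin ?(ltW Ctot0)// poweR_EFin -poweRrM mulfV ?gt_eqF//.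
by rewrite poweRe1.
Qed.
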